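(* Let $N,m,\Delta,r,s$ be positive integers with $r\ge 2$, and let $\mathcal{F}=(f_1,\dots,f_m)$ where each $f_i\colon\mathbb{R}^N\to\mathbb{R}$ has the form $f_i=\sum_{j=1}^{r_i}a_{i,j}\,g_{i,j}^{1/s}$, with $r_i\le r$ a positive integer, each $a_{i,j}\in\mathbb{R}$, and each $g_{i,j}\in\mathbb{R}[x_1,\dots,x_N]$ a polynomial of degree at most $\Delta$ satisfying $g_{i,j}(x)\ge 0$ for all $x\in\mathbb{R}^N$. Then the number of distinct proper sign patterns of the form $\varepsilon_{\mathcal{F}}(x)$, $x\in\mathbb{R}^N$, is at most $2(2s^{r-2}\Delta)^N\sum_{\ell=0}^N 2^\ell\binom{m}{\ell}$.
   Context: For a tuple $\mathcal{F}=(f_1,\dots,f_m)$ of real-valued functions on $\mathbb{R}^N$ and $x\in\mathbb{R}^N$, the sign pattern is $\varepsilon_{\mathcal{F}}(x)=(\operatorname{sgn} f_1(x),\dots,\operatorname{sgn} f_m(x))\in\{0,1,-1\}^m$. A sign pattern is proper if all its entries are nonzero. Here $g^{1/s}$ denotes the nonnegative real $s$-th root. *)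

(* Defs.v *)
From mathcomp Require Import all_boot all_order all_algebra.
From mathcomp Require Import boolp classical_sets reals.

Set Implicit Arguments.
Unset Strict Implicit.
Unset Printing Implicit Defensive.

Local Open Scope classical_set_scope.
Local Open Scope ring_scope.

(* The entries are sgz values, i.e. the integers 0, 1 and -1. *)
Definition sign_pattern (R : realType) (N m : nat)
    (F : 'I_m -> ('I_N -> R) -> R) (x : 'I_N -> R) : {ffun 'I_m -> int} :=
  [ffun i => sgz (F i x)].

Definition proper_pattern (m : nat) (e : {ffun 'I_m -> int}) : Prop :=
  forall i, e i != 0.

Definition proper_sign_patterns (R : realType) (N m : nat)
    (F : 'I_m -> ('I_N -> R) -> R) : set {ffun 'I_m -> int} :=
  [set e | proper_pattern e /\ exists x : 'I_N -> R, sign_pattern F x = e].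

(* Main.v *)
Require Import Defs.
From mathcomp Require Import all_boot all_order all_algebra.
From mathcomp Require Import boolp classical_sets cardinality reals exp.
From mathcomp Require Import perm lra ring zify.
From mathcomp Require topology normedtype derive.

(* The norm of [f_i] (the product of its conjugates) is a polynomial [P_i] of
   degree at most D = s^(r-2) Delta whose zeros contain those of [f_i]; after a
   small change of the coefficients [a_(i,j)], no [P_i] vanishes at the chosen representatives
   of the sign patterns.  It remains to bound the number of cells of the
   complement of the hypersurfaces P_i = 0 that meet these points.  Cut the
   cells down to compact sets |P_i| >= eps_i inside a large ball, with generic
   levels eps_i so that at most N of them are attained at any point.  A generic
   linear tilt h of sum_j x_j^(2D+1) has a unique minimum y on each compact cell;
   it is a strict local minimum of h on the set where the active [P_i] keep their
   values.  For small delta, sum_(i active) (P_i - P_i(y))^2 + delta h then has a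
   critical point close to y.  Its critical equations are
   x_j^(2D) = (terms of degree < 2D), so they have at most (2D)^N solutions, and
   it remains to count the possible active sets with their signs. *)

Set Implicit Arguments.
Unset Strict Implicit.
Unset Printing Implicit Defensive.

Import Order.TTheory GRing.Theory Num.Theory.
Local Open Scope ring_scope.

(** * Continuity and minima *)

(** Sup-distance continuity over an arbitrary finite index type, so that a family of [K] points can
    be treated as one point indexed by ['I_K * 'I_N]. *)
Definition fcont (R : realType) (J : finType) (f : (J -> R) -> R) : Prop :=
  forall (x : J -> R) (e : R), 0 < e ->
  exists2 d : R, 0 < d &
    forall y, (forall j, `|y j - x j| < d) -> `|f y - f x| < e.

Module Topological.
Local Open Scope classical_set_scope.
Import topology normedtype derive.
Import numFieldNormedType.Exports.

Section Fcont.
Context (R : realType) (J : finType).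
Implicit Types f g : (J -> R) -> R.

Definition of_row (v : 'rV[R]_#|J|) : J -> R := fun j => v 0 (enum_rank j).

Definition to_row (x : J -> R) : 'rV[R]_#|J| := \row_k x (enum_val k).

Lemma to_rowK : cancel to_row of_row.
Proof. by move=> x; apply/funext => j; rewrite /of_row mxE enum_rankK. Qed.

Lemma fcont_continuous f : fcont f <-> continuous (f \o of_row).
Proof.
split => [cf v|cf x e e0].
  apply/(@cvgrPdist_lt _ _ _ (nbhs v) (nbhs_filter v)) => e e0; have [d d0 fd] := cf (of_row v) e e0.
  apply/nbhs_ballP; exists d => // w [_ vw]; rewrite /= distrC; apply: fd => j.
  by have := vw 0 (enum_rank j); rewrite -ball_normE /= distrC.
have := cf (to_row x); rewrite /continuous_at /= to_rowK => /cvgrPdist_lt/(_ _ e0).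
move=> /nbhs_ballP[d /= d0 fd]; exists d => // y xy.
have := fd (to_row y); rewrite /= to_rowK distrC; apply; split => // i j.
by rewrite !mxE -ball_normE /= distrC.
Qed.

Lemma fcontD f g : fcont f -> fcont g -> fcont (fun x => f x + g x).
Proof.
move=> /fcont_continuous cf /fcont_continuous cg; apply/fcont_continuous => v.
exact: (@continuousD _ _ _ (f \o of_row) (g \o of_row) v (cf v) (cg v)).
Qed.

Lemma fcontM f g : fcont f -> fcont g -> fcont (fun x => f x * g x).
Proof.
move=> /fcont_continuous cf /fcont_continuous cg; apply/fcont_continuous => v.
exact: (@continuousM _ _ (f \o of_row) (g \o of_row) v (cf v) (cg v)).
Qed.

(** The feasible set is closed, as an intersection of preimages of a half-line, and bounded, hence
    compact; the extreme value theorem applies. *)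
Lemma fcont_min (C : Type) (phi : C -> (J -> R) -> R) (M : R) f (x0 : J -> R) :
    (forall c, fcont (phi c)) -> fcont f ->
    (forall c, 0 <= phi c x0) ->
    (forall x, (forall c, 0 <= phi c x) -> forall j, `|x j| <= M) ->
  exists2 x, forall c, 0 <= phi c x &
    forall y, (forall c, 0 <= phi c y) -> f x <= f y.
Proof.
move=> cphi /fcont_continuous cf phi0 bnd.
pose A : set 'rV[R]_#|J| := [set v | forall c, 0 <= phi c (of_row v)].
have cA : compact A.
  apply: bounded_closed_compact.
    exists (Num.max M 0); split; first by rewrite realE le_max lexx orbT.
    move=> N /= MN v Av; have N0 : 0 <= N.
      by rewrite ltW // (le_lt_trans _ MN)// le_max lexx orbT.
    rewrite /Num.norm /= mx_normrE; apply/bigmax_leP; split => // -[i j] _ /=.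
    rewrite ord1; have /= := bnd _ Av (enum_val j); rewrite /of_row enum_valK.
    by move=> /le_trans; apply; rewrite ltW // (le_lt_trans _ MN)// le_max lexx.
  have -> : A = \bigcap_(c in setT) ((phi c \o of_row) @^-1` [set y | 0 <= y]).
    by apply/seteqP; split=> [v Av c _|v Av c]; [exact: Av|exact: (Av c I)].
  apply: closed_bigI => c _; apply: closed_comp => [v _|]; last exact: closed_ge.
  by move: (cphi c) => /fcont_continuous; apply.
have [||w Aw minw] := @EVT_min_rV R _ (f \o of_row) A _ cA _.
- by exists (to_row x0) => c; rewrite to_rowK.
- by apply: continuous_subspaceT => v; exact: cf.
exists (of_row w) => [c|y Ay]; first by move: Aw; rewrite inE => /(_ c).
rewrite -[y]to_rowK; apply: minw; rewrite inE => c; rewrite to_rowK; exact: Ay.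
Qed.

End Fcont.
End Topological.

Import Topological.

Section FcontTheory.
Context (R : realType).
Implicit Types J : finType.

Lemma fcont_cst J (c : R) : fcont (fun _ : J -> R => c).
Proof. by move=> x e e0; exists 1 => // y _; rewrite subrr normr0. Qed.

Lemma fcont_coord J (j : J) : fcont (fun x : J -> R => x j).
Proof. by move=> x e e0; exists e => // y; apply. Qed.

Lemma eq_fcont J (f g : (J -> R) -> R) : f =1 g -> fcont f -> fcont g.
Proof. by move=> /funext ->. Qed.

Lemma fcontZ J (c : R) (f : (J -> R) -> R) : fcont f -> fcont (fun x => c * f x).
Proof. by move=> cf; apply: fcontM => //; exact: fcont_cst. Qed.

Lemma fcontB J (f g : (J -> R) -> R) :
  fcont f -> fcont g -> fcont (fun x => f x - g x).
Proof.
move=> cf cg; apply: fcontD => //; apply: eq_fcont (fcontZ (-1) cg) => x.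
by rewrite mulN1r.
Qed.

Lemma fcont_exp J (f : (J -> R) -> R) n : fcont f -> fcont (fun x => f x ^+ n).
Proof.
move=> cf; elim: n => [|n ih]; first exact: fcont_cst.
by apply: eq_fcont (fcontM cf ih) => x; rewrite exprS.
Qed.

Lemma fcont_sum J (I : Type) (r : seq I) (P : pred I) (F : I -> (J -> R) -> R) :
  (forall i, fcont (F i)) -> fcont (fun x => \sum_(i <- r | P i) F i x).
Proof.
move=> cF; elim: r => [|i r ih].
  by apply: eq_fcont (@fcont_cst J 0) => x; rewrite big_nil.
case Pi: (P i); last by apply: eq_fcont ih => x; rewrite big_cons Pi.
by apply: eq_fcont (fcontD (cF i) ih) => x; rewrite big_cons Pi.
Qed.

Lemma fcont_prod J (I : Type) (r : seq I) (P : pred I) (F : I -> (J -> R) -> R) :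
  (forall i, fcont (F i)) -> fcont (fun x => \prod_(i <- r | P i) F i x).
Proof.
move=> cF; elim: r => [|i r ih].
  by apply: eq_fcont (@fcont_cst J 1) => x; rewrite big_nil.
case Pi: (P i); last by apply: eq_fcont ih => x; rewrite big_cons Pi.
by apply: eq_fcont (fcontM (cF i) ih) => x; rewrite big_cons Pi.
Qed.

Lemma fcont_reindex J J' (h : J -> J') (f : (J -> R) -> R) :
  fcont f -> fcont (fun x : J' -> R => f (fun j => x (h j))).
Proof.
move=> cf x e e0; have [d d0 fd] := cf (fun j => x (h j)) e e0.
by exists d => // y xy; apply: fd => j; exact: xy.
Qed.

Lemma fcont_norm J (f : (J -> R) -> R) : fcont f -> fcont (fun x => `|f x|).
Proof.
move=> cf x e e0; have [d d0 fd] := cf x e e0; exists d => // y /fd.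
exact: le_lt_trans (ler_dist_dist _ _).
Qed.

Lemma fcont_gt0 J (f : (J -> R) -> R) x : fcont f -> 0 < f x ->
  exists2 d, 0 < d & forall y, (forall j, `|y j - x j| < d) -> 0 < f y.
Proof.
move=> cf fx0; have [d d0 fd] := cf x (f x) fx0; exists d => // y /fd.
by rewrite ltr_norml => /andP[]; rewrite ltrBrDl subrr.
Qed.

Lemma expr_diff_le (u v : R) n : 0 <= v <= u -> (u - v) ^+ n.+1 <= u ^+ n.+1 - v ^+ n.+1.
Proof.
move=> /andP[v0 vu]; rewrite lerBrDr.
have u0 : 0 <= u - v by rewrite subr_ge0.
rewrite -[u in leRHS](subrK v); elim: n (u - v) u0 {vu} => [|n ih] w w0.
  by rewrite !expr1.
rewrite [leRHS]exprS; have := ih w w0; set a := (w + v) ^+ _ => ha.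
have : (w + v) * (w ^+ n.+1 + v ^+ n.+1) <= (w + v) * a.
  by rewrite ler_wpM2l // addr_ge0.
apply: le_trans; rewrite mulrDl !mulrDr -!exprS.
have := mulr_ge0 w0 (exprn_ge0 n.+1 v0); have := mulr_ge0 v0 (exprn_ge0 n.+1 w0).
lra.
Qed.

Lemma powR_invn_expr (n : nat) (a : R) : 0 <= a -> (a `^ (n.+1%:R^-1)) ^+ n.+1 = a.
Proof.
move=> a0; rewrite -powR_mulrn ?powR_ge0 // -powRrM mulVf ?powRr1 //.
by rewrite pnatr_eq0.
Qed.

Lemma expr_dist_le (u v : R) n : 0 <= u -> 0 <= v ->
  `|u - v| ^+ n.+1 <= `|u ^+ n.+1 - v ^+ n.+1|.
Proof.
wlog vu : u v / v <= u.
  move=> wl u0 v0; have [/wl -> //|/ltW/wl wl'] := leP v u.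
  by rewrite distrC [leRHS]distrC wl'.
move=> u0 v0; rewrite !ger0_norm ?subr_ge0 ?lerXn2r //.
by apply: expr_diff_le; rewrite v0.
Qed.

(** The bound [expr_dist_le] makes the root Hoelder continuous, uniformly up to zero, so zeros of
    [g] need no separate treatment. *)
Lemma fcont_root J n (g : (J -> R) -> R) : fcont g -> (forall x, 0 <= g x) ->
  fcont (fun x => g x `^ (n.+1%:R^-1)).
Proof.
move=> cg g0 x e e0; have [d d0 gd] := cg x (e ^+ n.+1) (exprn_gt0 _ e0).
exists d => // y /gd gy; rewrite -(@ltr_pXn2r _ n.+1) ?nnegrE ?(ltW e0) //.
apply: le_lt_trans gy; rewrite -[g y in leRHS](powR_invn_expr n) //.
by rewrite -[g x in leRHS](powR_invn_expr n) // expr_dist_le // powR_ge0.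
Qed.

End FcontTheory.

From mathcomp Require Import mpoly.

(** * Degrees and numbers of zeros *)

Section Msize.
Context (R : idomainType) (n : nat).
Implicit Types p q : {mpoly R[n]}.

(** [msize] is the degree plus one and is [0] at the zero polynomial, so a bound [msize p <= a.+1]
    covers the zero polynomial as well. *)
Lemma msizeM_leq a b p q :
  (msize p <= a.+1 -> msize q <= b.+1 -> msize (p * q) <= (a + b).+1)%N.
Proof.
have [->|p0] := eqVneq p 0; first by rewrite mul0r msize0.
have [->|q0] := eqVneq q 0; first by rewrite mulr0 msize0.
by rewrite msizeM //; lia.
Qed.

Lemma msize_prod_leq (I : Type) (r : seq I) (P : pred I)
    (F : I -> {mpoly R[n]}) (w : I -> nat) :
  (forall i, P i -> (msize (F i) <= (w i).+1)%N) ->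
  (msize (\prod_(i <- r | P i) F i) <= (\sum_(i <- r | P i) w i).+1)%N.
Proof.
move=> FP; apply: (big_ind2 (fun p a => (msize p <= a.+1)%N)) => //.
- by rewrite msize1.
- by move=> p a q b; exact: msizeM_leq.
Qed.

Lemma msizeX_leq a p k : (msize p <= a.+1 -> msize (p ^+ k) <= (a * k).+1)%N.
Proof.
move=> pa; elim: k => [|k ih]; first by rewrite expr0 muln0 msize1.
by rewrite exprS mulnS msizeM_leq.
Qed.

Lemma msizeD_leq a p q : (msize p <= a -> msize q <= a -> msize (p + q) <= a)%N.
Proof. by move=> pa qa; rewrite (leq_trans (msizeD_le p q)) // geq_max pa. Qed.

Lemma msize_sum_leq (I : Type) (r : seq I) (P : pred I) (F : I -> {mpoly R[n]}) a :
  (forall i, P i -> (msize (F i) <= a)%N) -> (msize (\sum_(i <- r | P i) F i) <= a)%N.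
Proof.
move=> FP; apply: (big_ind (fun p => (msize p <= a)%N)) => //.
- by rewrite msize0.
- by move=> p q; exact: msizeD_leq.
Qed.

Lemma msize_deriv_leq a p i : (msize p <= a.+1 -> msize p^`M(i) <= a)%N.
Proof.
move=> pa; rewrite msizeE; apply/bigmax_leqP_seq => m + _.
rewrite mcoeff_msupp mcoeff_mderiv => h.
have : (m + U_(i))%MM \in msupp p.
  by rewrite mcoeff_msupp; apply: contra_neq h => ->; rewrite mul0rn.
by move=> /msize_mdeg_lt; rewrite mdegD mdeg1 addn1 => /leq_trans/(_ pa).
Qed.

End Msize.

Section Interpolation.
Context (F : fieldType) (n K : nat) (z : 'I_K -> 'I_n -> F).
Hypothesis z_inj : injective z.

(** For each [j != k] some coordinate separates [z j] from [z k], giving an affine form with value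
    [1] at [z k] and [0] at [z j]; [L] is their product. *)
Lemma mpoly_lagrange k : exists L : {mpoly F[n]}, forall j, L.@[z j] = (j == k)%:R.
Proof.
have sep j : exists p : {mpoly F[n]},
    p.@[z k] = 1 /\ (j != k -> p.@[z j] = 0).
  have [->|jk] := eqVneq j k; first by exists 1; rewrite meval1.
  have [i ij] : exists i, z j i != z k i.
    apply/existsP; rewrite -negb_forall; apply/negP => /forallP zjk.
    by move/eqP: jk; apply; apply: z_inj; apply/funext => i; apply/eqP/zjk.
  exists ((z k i - z j i)^-1 *: ('X_i - (z j i)%:MP)).
  rewrite !mevalZ !mevalB !mevalXU !mevalC subrr mulr0 mulVf // subr_eq0.
  by rewrite eq_sym.
have [p hp] := choice sep.
exists (\prod_(j | j != k) p j) => j; rewrite rmorph_prod /=.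
have [->|jk] := eqVneq j k.
  by rewrite big1 // => i _; have [] := hp i.
by rewrite (bigD1 j) //= (hp j).2 // mul0r.
Qed.

(** By interpolation the value vectors of polynomials fill the whole space of dimension [K], which
    the [c] rows of [M] must then span. *)
Lemma points_le_rank c (M : 'M[F]_(c, K)) :
  (forall p : {mpoly F[n]}, (\row_j p.@[z j] <= M)%MS) -> (K <= c)%N.
Proof.
move=> hM; have : (1%:M <= M)%MS.
  apply/row_subP => k; have [L hL] := mpoly_lagrange k.
  suff -> : row k 1%:M = \row_j L.@[z j] by [].
  by apply/rowP => j; rewrite !mxE hL eq_sym.
by move=> /mxrankS; rewrite mxrank1 => /leq_trans; apply; exact: rank_leq_row.
Qed.

(* Modulo the equations every monomial reduces to the monomials with all
   exponents below [d], so evaluation at the zeros factors through a space of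
   dimension at most [d ^ n]. *)
Lemma zeros_le (d : nat) (c : F) (low : 'I_n -> {mpoly F[n]}) : c != 0 ->
    (forall i, (msize (low i) <= d)%N) ->
    (forall k i, (c *: 'X_i ^+ d + low i).@[z k] = 0) ->
  (K <= d ^ n)%N.
Proof.
move=> c0 slow zz.
have -> : (d ^ n = #|{: {ffun 'I_n -> 'I_d}}|)%N by rewrite card_ffun !card_ord.
pose mon (e : {ffun 'I_n -> 'I_d}) : 'X_{1..n} := [multinom (e i : nat) | i < n].
pose M : 'M[F]_(#|{: {ffun 'I_n -> 'I_d}}|, K) :=
  \matrix_(a, j) ('X_[mon (enum_val a)] : {mpoly F[n]}).@[z j].
apply: (@points_le_rank _ M) => p.
have [t] := ubnP (msize p); elim: t p => // t ih p.
rewrite ltnS => pt.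
have -> : \row_j p.@[z j] = \sum_(m <- msupp p) p@_m *: \row_j ('X_[m] : {mpoly F[n]}).@[z j].
  apply/rowP => j; rewrite summxE !mxE {1}[p]mpolyE raddf_sum /=.
  by apply: eq_bigr => m _; rewrite !mxE mevalZ.
rewrite big_seq; apply: summx_sub => m mp; apply: scalemx_sub.
have [/forallP mlt|] := boolP [forall i, (m i < d)%N].
  pose e : {ffun 'I_n -> 'I_d} := [ffun i => Ordinal (mlt i)].
  have -> : \row_j ('X_[m] : {mpoly F[n]}).@[z j] = row (enum_rank e) M.
    apply/rowP => j; rewrite !mxE enum_rankK; congr (_.@[_]); congr 'X_[_].
    by apply/mnmP => i; rewrite mnmE ffunE.
  exact: row_sub.
rewrite negb_forall => /existsP[i]; rewrite -leqNgt => dmi.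
have mE : m = (U_(i) *+ d + (m - U_(i) *+ d))%MM.
  apply/mnmP => j; rewrite mnmDE mnmBE mulmnE mnm1E.
  by case: eqVneq => [<-|_]; rewrite ?mul1n ?mul0n; lia.
set m' := (m - _)%MM in mE.
(* At the zeros [X_i ^ d] equals [- c^-1 * low i], and [low i] has degree below [d], so the
   replacement lowers the size and the induction applies. *)
have -> : \row_j ('X_[m] : {mpoly F[n]}).@[z j] =
    (- c^-1) *: \row_j (low i * 'X_[m']).@[z j].
  apply/rowP => j; rewrite !mxE mE mpolyXD -mpolyXn !mevalM mulrA.
  congr (_ * _); have := zz j i; rewrite mevalD mevalZ => /eqP.
  by rewrite addr_eq0 => /eqP /(canRL (mulKf c0)) ->; rewrite mulrN mulNr.
apply: scalemx_sub; apply: ih.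
have mdm : (mdeg m < t)%N by exact: leq_trans (msize_mdeg_lt mp) pt.
have : (msize (low i * 'X_[m']) <= d + mdeg m')%N.
  have [->|l0] := eqVneq (low i) 0; first by rewrite mul0r msize0.
  rewrite msizeM // ?msizeX; last by rewrite -msize_poly_eq0 msizeX.
  by rewrite addnS /= leq_add2r.
move=> /leq_ltn_trans; apply; move: mdm; rewrite {1}mE mdegD mdegMn mdeg1 mul1n.
by [].
Qed.

End Interpolation.

(** * Generic levels and critical points *)

(** All coefficients sit on the [t ^ n] monomials with exponents below [t], so the coefficient
    matrix has a nonzero left kernel vector. *)
Lemma mpoly_dependent (F : fieldType) (n t : nat) (E : finType)
    (p : E -> {mpoly F[n]}) :
    (forall e, (msize (p e) <= t)%N) -> (t ^ n < #|E|)%N ->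
  exists2 c : E -> F, exists e, c e != 0 & \sum_e c e *: p e = 0.
Proof.
move=> pt tE.
pose mon (e : {ffun 'I_n -> 'I_t}) : 'X_{1..n} := [multinom (e i : nat) | i < n].
pose A : 'M[F]_(#|E|, #|{: {ffun 'I_n -> 'I_t}}|) :=
  \matrix_(a, b) (p (enum_val a))@_(mon (enum_val b)).
have kA : kermx A != 0.
  rewrite -mxrank_eq0 mxrank_ker -lt0n subn_gt0.
  by rewrite (leq_ltn_trans (rank_leq_col _)) // card_ffun !card_ord.
have [v vk v0] : exists2 v : 'rV_#|E|, (v <= kermx A)%MS & v != 0.
  by exists (nz_row (kermx A)); [exact: nz_row_sub|rewrite nz_row_eq0].
move: vk => /sub_kermxP vA.
exists (fun e => v 0 (enum_rank e)).
  have /rV0Pn[a va] := v0; by exists (enum_val a); rewrite enum_valK.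
apply/mpolyP => m; rewrite raddf_sum mcoeff0 /=.
under eq_bigr do rewrite mcoeffZ.
have [/forallP mt|] := boolP [forall i, (m i < t)%N]; last first.
  rewrite negb_forall => /existsP[i]; rewrite -leqNgt => ti.
  rewrite big1 // => e _; rewrite (@memN_msupp_eq0 _ _ _ m) ?mulr0 //.
  rewrite msize_mdeg_ge // (leq_trans (pt e)) // (leq_trans ti) // mdegE.
  by rewrite (bigD1 i) //= leq_addr.
pose b : {ffun 'I_n -> 'I_t} := [ffun i => Ordinal (mt i)].
have bm : mon b = m by apply/mnmP => i; rewrite mnmE ffunE.
have := congr1 (fun M : 'rV_ _ => M 0 (enum_rank b)) vA; rewrite !mxE; apply: eq_trans.
rewrite (reindex (fun a : 'I_#|E| => enum_val a)) /=; last first.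
  exact: onW_bij _ (enum_val_bij _).
by apply: eq_bigr => a _; rewrite !mxE enum_rankK bm enum_valK.
Qed.

Lemma digits_inj (B n : nat) (d d' : nat -> nat) :
    (forall i, d i < B)%N -> (forall i, d' i < B)%N ->
    (\sum_(i < n) d i * B ^ i = \sum_(i < n) d' i * B ^ i)%N ->
  forall i, (i < n)%N -> d i = d' i.
Proof.
elim: n d d' => // n ih d d' dB d'B.
have step (f : nat -> nat) : (\sum_(i < n.+1) f i * B ^ i =
    (\sum_(i < n) f i.+1 * B ^ i) * B + f 0)%N.
  rewrite big_ord_recl /= expn0 muln1 addnC big_distrl /=; congr (_ + _)%N.
  by apply: eq_bigr => i _; rewrite /bump /= add1n expnSr mulnA.
rewrite !step => e.
have e0 : d 0%N = d' 0%N.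
  have := congr1 (modn^~ B) e.
  by rewrite !modnMDl !modn_small ?dB ?d'B.
have B0 : (0 < B)%N by exact: leq_ltn_trans (dB 0%N).
case=> // i; rewrite ltnS => iln; apply: (ih (d \o succn) (d' \o succn)) => //=.
by move: e; rewrite e0 => /addIn/eqP; rewrite eqn_pmul2r // => /eqP.
Qed.

(** Kronecker substitution: reading exponents as base [B] digits keeps distinct monomials distinct
    after each variable is replaced by a power [t ^ (B ^ i)]. *)
Lemma kronecker_inj (B n : nat) (J : finType) (w : J -> 'I_n) : injective w ->
  injective (fun e : {ffun J -> 'I_B} => \sum_j e j * B ^ w j)%N.
Proof.
move=> winj e e' /= eq_e.
have [B0|B0] := posnP B; first by apply/ffunP => j; exfalso; have := ltn_ord (e j); lia.
pose dig (e : {ffun J -> 'I_B}) (i : nat) : nat :=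
  (\sum_(j | w j == i :> nat) e j)%N.
have digw f j : dig f (w j) = f j :> nat.
  rewrite /dig (big_pred1 j) // => j' /=; apply/idP/idP => [/eqP h|/eqP-> //].
  by apply/eqP/winj/val_inj.
have digB f i : (dig f i < B)%N.
  have [/existsP[j /eqP <-]|] := boolP [exists j, w j == i :> nat].
    by rewrite digw.
  rewrite negb_exists => /forallP nw; rewrite /dig big1 // => j wji.
  by move: (nw j); rewrite wji.
have sumE (f : {ffun J -> 'I_B}) : (\sum_j f j * B ^ w j = \sum_(i < n) dig f i * B ^ i)%N.
  rewrite (partition_big w predT) //=; apply: eq_bigr => i _.
  rewrite /dig big_distrl /=; apply: eq_big => [j|j /eqP -> //].
  by [].
apply/ffunP => j; apply: val_inj; rewrite /= -!digw.
by apply: (@digits_inj B n) => //; rewrite -!sumE.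
Qed.

(** The candidates [eta / k.+2] for [k < size q] are distinct, lie strictly between [0] and [eta],
    and are one more than the degree of [q]. *)
Lemma nonroot_small (R : realFieldType) (q : {poly R}) (eta : R) :
  q != 0 -> 0 < eta -> exists2 t, 0 < t < eta & ~~ root q t.
Proof.
move=> q0 eta0; apply: contrapT => h.
pose s := [seq eta / k.+2%:R | k <- iota 0 (size q)].
have us : uniq s.
  rewrite map_inj_in_uniq ?iota_uniq // => a b _ _ /(mulfI (lt0r_neq0 eta0)).
  by move/invr_inj/eqP; rewrite eqr_nat => /eqP [].
have : all (root q) s.
  apply/allP => _ /mapP[k _ ->]; apply/negPn/negP => nr; apply: h.
  exists (eta / k.+2%:R) => //; rewrite divr_gt0 ?ltr0n //=.
  by rewrite ltr_pdivrMr ?ltr0n // ltr_pMr // ltr1n.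
by move=> /(max_poly_roots q0)/(_ us); rewrite size_map size_iota ltnn.
Qed.

(* Any [N + 1] of the polynomials are algebraically dependent, so the levels
   [t ^+ B ^ i], [B] large, can be attained simultaneously by [N + 1] of them
   only for finitely many [t]. *)
Lemma generic_levels (R : realType) (N : nat) (I : finType)
    (P : I -> {mpoly R[N]}) (eta : R) : 0 < eta ->
  exists2 eps : I -> R, forall i, 0 < eps i < eta &
    forall x, (#|[set i | `|(P i).@[x]|%R == eps i]| <= N)%N.
Proof.
move=> eta0; pose D := (\max_i msize (P i))%N.
have PD i : (msize (P i) <= D.+1)%N by rewrite leqW // leq_bigmax.
(* The products [p e] below have size at most [b * B], hence live on [(b * B) ^ N] monomials, and
   there are [B ^ N.+1] of them; [B > b ^ N] forces a dependence. *)
pose b := (N.+1 * D.+1)%N; pose B := (b ^ N).+1; pose w := @enum_rank I.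
pose sg (tau : bool) : R := (-1) ^+ tau.
have dep (st : {ffun 'I_N.+1 -> I} * {ffun 'I_N.+1 -> bool}) :
    exists q : {poly R}, q != 0 /\ (injective st.1 ->
      forall t x, (forall j, (P (st.1 j)).@[x] = sg (st.2 j) * t ^+ (B ^ w (st.1 j))) ->
      root q t).
  case: st => sigma tau /=.
  have [sinj|] := pselect (injective sigma); last first.
    by move=> ns; exists 1; split=> [|/ns //]; exact: oner_neq0.
  pose p (e : {ffun 'I_N.+1 -> 'I_B}) := \prod_j P (sigma j) ^+ e j.
  have pt e : (msize (p e) <= b * B)%N.
    rewrite (leq_trans (msize_prod_leq (w := fun j => (D * e j)%N) _ _)) //.
      by move=> j _; exact: msizeX_leq.
    rewrite -big_distrr /=.
    have : (\sum_j e j <= N.+1 * (b ^ N))%N.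
      rewrite (leq_trans (@leq_sum _ _ _ _ (fun=> b ^ N)%N _)) //.
        by move=> j _; rewrite -ltnS.
      by rewrite sum_nat_const card_ord.
    rewrite /B {2}/b; move: (b ^ N)%N (\sum_j _)%N => X S SX.
    have := leq_mul (leqnn D) SX; have := leq0n (N * X); nia.
  have [|c [e0 ce0] cp] := mpoly_dependent pt.
    by rewrite card_ffun !card_ord expnMn expnS ltn_pmul2r // expn_gt0.
  pose ex (e : {ffun 'I_N.+1 -> 'I_B}) := (\sum_j e j * B ^ w (sigma j))%N.
  pose cc (e : {ffun 'I_N.+1 -> 'I_B}) := c e * \prod_j sg (tau j) ^+ e j.
  (* The dependence evaluated at the signed levels is a polynomial in [t]; it is nonzero because
     [kronecker_inj] keeps two terms from sharing an exponent. *)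
  exists (\sum_e cc e *: 'X^(ex e)); split.
    apply/eqP => /(congr1 (fun q : {poly R} => q`_(ex e0))).
    rewrite coef_sum coef0 (bigD1 e0) //= big1 => [|e ne].
      rewrite coefZ coefXn eqxx mulr1 addr0 => /eqP.
      rewrite mulf_eq0 (negPf ce0) /= prodf_seq_eq0 => /hasP[j _] /=.
      by rewrite /sg -exprM signr_eq0.
    rewrite coefZ coefXn; case: eqP => [h|]; last by rewrite mulr0.
    case/eqP: ne; apply: (@kronecker_inj B _ _ (fun j => w (sigma j))) => //.
    by move=> j j' /enum_rank_inj/sinj.
  move=> _ t x Px; rewrite /root horner_sum; apply/eqP.
  have := congr1 (fun p : {mpoly R[N]} => p.@[x]) cp.
  rewrite meval0 raddf_sum /=; apply: eq_trans.
  apply: eq_bigr => e _; rewrite hornerZ hornerXn mevalZ /cc -mulrA; congr (_ * _).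
  rewrite /p rmorph_prod /= /ex -prodrXr -big_split /=; apply: eq_bigr => j _.
  by rewrite rmorphXn /= Px exprMn; congr (_ * _); rewrite mulnC exprM.
have [q hq] := choice dep.
(* One [t] outside the roots of all [q st] handles every choice of indices and signs; [t < 1] keeps
   each of its powers below [eta]. *)
have [||t /andP[t0 tm] nr] := @nonroot_small _ (\prod_st q st) (Num.min eta 1).
- by apply/prodf_neq0 => st _; have [] := hq st.
- by rewrite lt_min eta0 ltr01.
move: tm; rewrite lt_min => /andP[teta t1].
exists (fun i => t ^+ (B ^ w i)) => [i|x].
  rewrite exprn_gt0 //= (le_lt_trans _ teta) //.
  by rewrite ler_iXnr ?expn_gt0 ?(ltW t0) ?(ltW t1).
rewrite leqNgt; apply/negP => cA; set A := [set i | _] in cA.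
pose sigma : {ffun 'I_N.+1 -> I} := [ffun j => enum_val (widen_ord cA j)].
have sA j : sigma j \in A by rewrite ffunE enum_valP.
pose tau : {ffun 'I_N.+1 -> bool} := [ffun j => (P (sigma j)).@[x] < 0].
have sinj : injective sigma.
  by move=> j j'; rewrite !ffunE => /enum_val_inj/(congr1 val) /= /val_inj.
move/negP: nr; apply; rewrite /root horner_prod.
apply/prodf_eq0; exists (sigma, tau) => //; apply: ((hq (sigma, tau)).2 sinj t x) => j /=.
move: (sA j); rewrite inE => /eqP <-; rewrite [tau j]ffunE /sg.
by rewrite {1}[LHS]realEsign ?num_real // mulrC.
Qed.

(** * First-order expansion and critical points of polynomials *)

Section Critical.
Context (R : realFieldType) (n : nat).
Implicit Types (p : {mpoly R[n]}) (x : 'I_n -> R).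

Definition shift x (i : 'I_n) (t : R) : 'I_n -> R := fun j => x j + t *+ (j == i).

(** Constants and variables have such an expansion, and sums and products inherit it; this ties the
    formal derivative to values along a coordinate line. *)
Lemma meval_taylor p x i : exists q : {poly R}, forall t,
  p.@[shift x i t] = p.@[x] + t * p^`M(i).@[x] + t ^+ 2 * q.[t].
Proof.
pose T p := exists q : {poly R}, forall t,
  p.@[shift x i t] = p.@[x] + t * p^`M(i).@[x] + t ^+ 2 * q.[t].
have TC c : T c%:MP.
  by exists 0 => t; rewrite mderivC meval0 !mevalC horner0 !mulr0 !addr0.
have TM p1 p2 : T p1 -> T p2 -> T (p1 * p2).
  move=> [q1 h1] [q2 h2].
  exists ((p1^`M(i).@[x] * p2^`M(i).@[x])%:P + p1.@[x] *: q2 + p2.@[x] *: q1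
    + 'X * (p1^`M(i).@[x] *: q2 + p2^`M(i).@[x] *: q1) + 'X^2 * (q1 * q2)) => t.
  rewrite mderivM !mevalM mevalD !mevalM h1 h2 !hornerE /=; ring.
have TD p1 p2 : T p1 -> T p2 -> T (p1 + p2).
  move=> [q1 h1] [q2 h2]; exists (q1 + q2) => t.
  rewrite mderivD !mevalD h1 h2 !hornerE /=; ring.
have TX j : T 'X_j.
  exists 0 => t; rewrite horner0 mulr0 addr0 !mevalXU mderivX mnm1E mevalZ.
  rewrite /shift; case: eqVneq => [->|_]; rewrite ?mul0r ?mulr0 ?mulr0n // mulr1n.
  by rewrite mul1r (_ : (U_(i) - U_(i))%MM = 0%MM) ?mpolyX0 ?meval1 ?mulr1 //;
     apply/mnmP => k; rewrite mnmBE subnn mnm0E.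
have T1 : T 1 by rewrite -mpolyC1; exact: TC.
suff: forall p, T p by exact.
apply: mpolyind => [|c m p' _ _ Tp]; first by rewrite -mpolyC0; exact: TC.
apply: TD => //; rewrite -mul_mpolyC; apply: (TM _ _) => //; rewrite mpolyXE_id.
apply: (big_ind T) => // j _; elim: (m j) => [|k ih]; first by rewrite expr0.
by rewrite exprS; exact: TM.
Qed.

Lemma poly_bound (q : {poly R}) :
  exists2 C, 0 <= C & forall t, `|t| <= 1 -> `|q.[t]| <= C.
Proof.
exists (\sum_(i < size q) `|q`_i|); first by apply: sumr_ge0.
move=> t t1; rewrite horner_coef; apply: le_trans (ler_norm_sum _ _ _) _.
apply: ler_sum => i _; rewrite normrM ler_piMr // normrX exprn_ile1 //.
Qed.

Lemma local_min_critical p x rho : 0 < rho ->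
    (forall y, (forall j, `|y j - x j| < rho) -> p.@[x] <= p.@[y]) ->
  forall i, p^`M(i).@[x] = 0.
Proof.
move=> rho0 pmin i; have [q hq] := meval_taylor p x i.
have [C C0 qC] := poly_bound q.
set a := _.@[x]; apply/eqP; apply: contraT => a0.
(* Moving by [- (a * s)] changes [p] by [a ^+ 2 * s * (s * Q - 1)], with [Q] the remainder value.
   This [s] keeps the move below [rho] and [1] and makes [s * C < 1], so the change is negative. *)
pose mu := Num.min rho 1; pose s := mu / ((`|a| + 1) * (C + 1)).
have mu0 : 0 < mu by rewrite lt_min rho0 ltr01.
have den0 : 0 < (`|a| + 1) * (C + 1) by rewrite mulr_gt0 // ltr_wpDl.
have s0 : 0 < s by rewrite divr_gt0.
have sa : `|a| * s < mu.
  rewrite /s mulrCA -[ltRHS]mulr1 ltr_pM2l // ltr_pdivrMr // mul1r.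
  have := normr_ge0 a; nra.
have sC : s * C < 1.
  have mu1 : mu <= 1 by rewrite ge_min lexx orbT.
  rewrite /s mulrAC ltr_pdivrMr // mul1r.
  have := normr_ge0 a; nra.
have nt : `|- (a * s)| < mu by rewrite normrN normrM (gtr0_norm s0).
have := pmin (shift x i (- (a * s))); rewrite hq -/a => /(_ _)/le_trans => pm.
have : p.@[x] <= p.@[x] + - (a * s) * a + (- (a * s)) ^+ 2 * q.[- (a * s)].
  apply: pm => [j|//]; rewrite /shift addrAC subrr add0r.
  case: (j == i); rewrite ?mulr1n ?mulr0n ?normr0 //.
  by apply: lt_le_trans nt _; rewrite ge_min lexx.
have := qC _ (ltW (lt_le_trans nt _)); rewrite ge_min lexx orbT => /(_ isT).
rewrite ler_norml => /andP[_]; set Q := q.[_] => QC h.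
have a2 : 0 < a ^+ 2 by rewrite exprn_even_gt0.
have sQ : s * Q < 1 by rewrite (le_lt_trans _ sC) // ler_pM2l.
have : 0 <= a ^+ 2 * s * (s * Q - 1) by nra.
have as0 : 0 < a ^+ 2 * s by exact: mulr_gt0.
by rewrite leNgt (pmulr_rlt0 _ as0) subr_lt0 sQ.
Qed.

End Critical.

(** * Counting cells *)

Lemma fcont_meval (R : realType) n (p : {mpoly R[n]}) : fcont (fun x => p.@[x]).
Proof.
apply: eq_fcont (fun x => esym (mevalE x p)) _; apply: fcont_sum => m.
by apply: fcontZ; apply: fcont_prod => i; apply: fcont_exp; exact: fcont_coord.
Qed.

Lemma pos_lower_bound (R : realDomainType) (J : finType) (d : J -> R) :
  (forall j, 0 < d j) -> exists2 e, 0 < e & forall j, e <= d j.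
Proof.
move=> d0; exists (\big[Num.min/1]_j d j).
  by apply: (big_ind (fun a => 0 < a)) => // a b a0 b0; rewrite lt_min a0.
by move=> j; rewrite (bigD1 j) //= ge_min lexx.
Qed.

(* At a minimiser [Y] of [sum_k h (Y k) - |sum_k Y k|^2], moving the single point
   [Y k] to [z] shows that [h - 2 (sum_k Y k) . x] grows by [|z - Y k|^2]. *)
Lemma strict_minimizers (R : realType) (N K : nat) (C : Type)
    (phi : 'I_K -> C -> ('I_N -> R) -> R) (h : ('I_N -> R) -> R)
    (x : 'I_K -> 'I_N -> R) (M : R) :
    (forall k c, fcont (phi k c)) -> fcont h ->
    (forall k c, 0 <= phi k c (x k)) ->
    (forall k z, (forall c, 0 <= phi k c z) -> forall j, `|z j| <= M) ->
  exists a : 'I_N -> R, exists2 y : 'I_K -> 'I_N -> R,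
    forall k c, 0 <= phi k c (y k) &
    forall k z, (forall c, 0 <= phi k c z) -> z <> y k ->
      h (y k) + \sum_i a i * y k i < h z + \sum_i a i * z i.
Proof.
move=> cphi ch phi0 bnd.
pose row (Y : 'I_K * 'I_N -> R) k : 'I_N -> R := fun i => Y (k, i).
(* One tilt has to serve all [K] sets, so the points are minimised jointly, over the product of the
   sets. *)
pose G Y := \sum_k h (row Y k) - \sum_i (\sum_k row Y k i) ^+ 2.
have cG : fcont G.
  apply: fcontB; apply: fcont_sum => k; first exact: (fcont_reindex (pair k) ch).
  by apply: fcont_exp; apply: fcont_sum => l; exact: (fcont_coord (l, k)).
have [|||Y|Y Yphi Ymin] := @fcont_min R _ ('I_K * C)%type
  (fun kc Y => phi kc.1 kc.2 (row Y kc.1)) M G (fun ki => x ki.1 ki.2).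
- by case=> k c; exact: (fcont_reindex (pair k) (cphi k c)).
- exact: cG.
- by case=> k c /=; exact: phi0.
- by move=> h0 [k i]; apply: (bnd k (row Y k)) => c; exact: (h0 (k, c)).
pose S i := \sum_k row Y k i.
exists (fun i => - 2 * S i), (row Y) => [k c|k z zphi zy].
  exact: (Yphi (k, c)).
pose Y' li := if li.1 == k then z li.2 else Y li.
have rY'k : row Y' k = z by apply/funext => i; rewrite /row /Y' /= eqxx.
have rY' l : l != k -> row Y' l = row Y l.
  by move=> lk; apply/funext => i; rewrite /row /Y' /= (negPf lk).
have : G Y <= G Y'.
  apply: Ymin => -[l c] /=.
  have [->|lk] := eqVneq l k; first by rewrite rY'k.
  by rewrite rY' //; exact: (Yphi (l, c)).
have S' i : \sum_l row Y' l i = S i + (z i - row Y k i).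
  rewrite /S (bigD1 k) //= rY'k [in RHS](bigD1 k) //=.
  under eq_bigr do rewrite rY' //.
  by ring.
have dpos : 0 < \sum_i (z i - row Y k i) ^+ 2.
  have [i zi] : exists i, z i != row Y k i.
    apply: contrapT => nz; apply: zy; apply/funext => i; apply/eqP.
    by apply: contrapT => /negP ni; apply: nz; exists i.
  rewrite (bigD1 i) //= ltr_pwDl ?sumr_ge0 // => [|j _]; last exact: sqr_ge0.
  by rewrite exprn_even_gt0 //= subr_eq0.
rewrite /G (bigD1 k) //= [in leRHS](bigD1 k) //= rY'k.
under [in leRHS]eq_bigr do rewrite rY' //.
under [\sum_i (\sum_k row Y' k i) ^+ 2]eq_bigr do rewrite S'.
rewrite -/(S _).
have -> : \sum_i (S i + (z i - row Y k i)) ^+ 2 = \sum_i S i ^+ 2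
    - \sum_i (- 2 * S i * z i) + \sum_i (- 2 * S i * row Y k i)
    + \sum_i (z i - row Y k i) ^+ 2.
  rewrite -sumrB -!big_split /=; apply: eq_bigr => i _; ring.
have -> : \sum_i (\sum_k row Y k i) ^+ 2 = \sum_i S i ^+ 2 by [].
move: dpos; lra.
Qed.

(** For small [d] a minimiser of [Q + d *: h] on the closed box is interior, hence critical: on the
    boundary either [h] exceeds its value at [y], or [Q] is at least some [q > 0], more than [d]
    times the largest possible drop of [h]. *)
Lemma penalty_critical (R : realType) (N : nat) (Q h : {mpoly R[N]})
    (y : 'I_N -> R) (rho : R) : 0 < rho ->
    (forall z, 0 <= Q.@[z]) -> Q.@[y] = 0 ->
    (forall z, (forall j, `|z j - y j| <= rho) -> Q.@[z] = 0 -> z <> y ->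
      h.@[y] < h.@[z]) ->
  exists2 d0, 0 < d0 & forall d, 0 < d < d0 ->
    exists2 z, forall j, `|z j - y j| < rho &
      forall i, (Q + d *: h)^`M(i).@[z] = 0.
Proof.
move=> rho0 Q0 Qy hmin.
pose box (j : 'I_N) (z : 'I_N -> R) := rho - `|z j - y j|.
have cbox j : fcont (box j).
  apply: fcontB; first exact: fcont_cst.
  by apply: fcont_norm; apply: fcontB; [exact: fcont_coord|exact: fcont_cst].
pose M := \sum_j `|y j| + rho.
have bnd (z : 'I_N -> R) : (forall j, 0 <= box j z) -> forall j, `|z j| <= M.
  move=> bz j; have := bz j; rewrite subr_ge0 => zy.
  have -> : z j = y j + (z j - y j) by ring.
  apply: le_trans (ler_normD _ _) _; apply: lerD => //.
  by rewrite (bigD1 j) //= lerDl sumr_ge0.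
have yin j : 0 <= box j y by rewrite /box subrr normr0 subr0 ltW.
have [zh zhin zhmin] := fcont_min cbox (fcont_meval h) yin bnd.
(* Boundary points with [h.@[z] <= h.@[y]] form a compact set without zeros of [Q]; the boundary is
   expressed by the vanishing product of the slacks [box j]. *)
have [q q0 Qq] : exists2 q, 0 < q & forall z, (forall j, 0 <= box j z) ->
    \prod_j box j z <= 0 -> h.@[z] <= h.@[y] -> q <= Q.@[z].
  pose psi (c : option (option 'I_N)) (z : 'I_N -> R) := match c with
    | Some (Some j) => box j z
    | Some None => - \prod_j box j z
    | None => h.@[y] - h.@[z] end.
  have [[w wpsi]|nw] := pselect (exists w, forall c, 0 <= psi c w); last first.
    exists 1 => // z bz pz hz; exfalso; apply: nw; exists z => -[[j|]|] /=.
    - exact: bz.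
    - by rewrite oppr_ge0.
    - by rewrite subr_ge0.
  have cpsi c : fcont (psi c).
    case: c => [[j|]|] /=; first exact: cbox.
    - have := fcontZ (-1) (fcont_prod (index_enum 'I_N) predT cbox).
      by apply: eq_fcont => z; rewrite mulN1r.
    - by apply: fcontB; [exact: fcont_cst|exact: fcont_meval].
  have [z zz|u upsi umin] := fcont_min cpsi (fcont_meval Q) wpsi (M := M).
    by apply: bnd => j; exact: (zz (Some (Some j))).
  exists Q.@[u]; last first.
    move=> z bz pz hz; apply: umin => -[[j|]|] /=; first exact: bz.
      by rewrite oppr_ge0.
    by rewrite subr_ge0.
  rewrite lt_neqAle Q0 andbT eq_sym; apply/eqP => Qu.
  have := upsi None; rewrite /= subr_ge0 leNgt => /negP; apply.
  apply: hmin => // [j|uy]; first by rewrite -subr_ge0; exact: (upsi (Some (Some j))).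
  have := upsi (Some None); rewrite /= oppr_ge0 leNgt => /negP; apply.
  by apply: prodr_gt0 => j _; rewrite /box uy subrr normr0 subr0.
have hM : 0 <= h.@[y] - h.@[zh] by rewrite subr_ge0; exact: zhmin.
exists (q / (h.@[y] - h.@[zh] + 1)); first by rewrite divr_gt0 // ltr_wpDl.
move=> d /andP[d0]; rewrite ltr_pdivlMr ?ltr_wpDl // => dq.
have [z zin zmin] := fcont_min cbox (fcont_meval (Q + d *: h)) yin bnd.
have zint j : 0 < box j z.
  rewrite lt_neqAle zin andbT eq_sym; apply/eqP => bjz.
  have pz : \prod_j box j z <= 0 by rewrite (bigD1 j) //= bjz mul0r.
  have := zmin y yin; rewrite !mevalD !mevalZ Qy.
  have [hz|hz] := leP h.@[z] h.@[y].
    have := Qq z zin pz hz; have := zhmin z zin; move: dq d0 hM hz; nra.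
  by have := Q0 z; move: hz d0; nra.
exists z => [j|i]; first by rewrite -subr_gt0; exact: zint.
have [e e0 eb] := pos_lower_bound zint.
apply: (@local_min_critical _ _ _ _ e) => // w we.
apply: zmin => j; rewrite subr_ge0.
have -> : w j - y j = (w j - z j) + (z j - y j) by ring.
apply: le_trans (ler_normD _ _) _; rewrite -lerBrDr.
exact: ltW (lt_le_trans (we j) (eb j)).
Qed.

Definition tilted_power_sum (R : realType) (N d : nat) (a : 'I_N -> R) : {mpoly R[N]} :=
  \sum_i 'X_i ^+ d + \sum_i a i *: 'X_i.

(** Each partial derivative involves only its own variable, which yields the diagonal leading terms
    required by [zeros_le]. *)
Lemma mderiv_tilted_power_sum (R : realType) (N d : nat) (a : 'I_N -> R) i :
  (tilted_power_sum d.+1 a)^`M(i) = d.+1%:R *: 'X_i ^+ d + (a i)%:MP.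
Proof.
have UU (m : 'X_{1..N}) : (m + U_(i) - U_(i))%MM = m by rewrite addmK.
rewrite mderivD !raddf_sum /=; congr (_ + _).
  rewrite (bigD1 i) //= big1 ?addr0 => [|j ji].
    rewrite mpolyXn mderivX mulmnE mnm1E eqxx mul1n mpolyXn.
    by rewrite mulmSr UU.
  by rewrite mpolyXn mderivX mulmnE mnm1E (negPf ji) scale0r.
rewrite (bigD1 i) //= big1 ?addr0 => [|j ji].
  rewrite mderivZ mderivX mnm1E eqxx scale1r -{1}[U_(i)%MM]add0m UU mpolyX0.
  by rewrite -mul_mpolyC mulr1.
by rewrite mderivZ mderivX mnm1E (negPf ji) scale0r scaler0.
Qed.

(** * Codes of the cells and their multiplicity *)

Section Cells.
Context (R : realType) (N D K : nat) (I : finType).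
Variables (P : I -> {mpoly R[N]}) (F : I -> ('I_N -> R) -> R).
Variables (x : 'I_K -> 'I_N -> R) (M : R).
Hypothesis D_gt0 : (0 < D)%N.
Hypothesis P_size : forall i, (msize (P i) <= D.+1)%N.
Hypothesis F_cont : forall i, fcont (F i).
Hypothesis PF_neq0 : forall i z, (P i).@[z] != 0 -> F i z != 0.
Hypothesis P_neq0 : forall k i, (P i).@[x k] != 0.
Hypothesis F_sep : forall k l, k != l -> exists i, F i (x k) * F i (x l) < 0.
Hypothesis F_bounded :
  forall k z, (forall i, 0 <= F i z * F i (x k)) -> forall j, `|z j| <= M.

(* [Some b] records that [|P i|] sits at its level, with [b] the sign of [P i]. *)
Definition active_code (eps : I -> R) (y : 'I_N -> R) : {ffun I -> option bool} :=
  [ffun i => if `|(P i).@[y]| == eps i then Some ((P i).@[y] < 0) else None].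

(** Margins are measured with the polynomials [P], which keeps the later critical equations
    algebraic, while the cell itself is fixed by the signs of [F]. *)
Definition cell_constraint (eps : I -> R) (k : 'I_K) (c : I + I) (z : 'I_N -> R) : R :=
  match c with
  | inl i => `|(P i).@[z]| - eps i
  | inr i => F i z * F i (x k)
  end.

Definition level_square (eps : I -> R) (code : {ffun I -> option bool}) : {mpoly R[N]} :=
  \sum_i (if code i is Some b then (P i - ((-1) ^+ b * eps i)%:MP) ^+ 2 else 0).

Lemma level_square_ge0 eps code z : 0 <= (level_square eps code).@[z].
Proof.
rewrite raddf_sum sumr_ge0 // => i _; case: (code i) => [b|] /=.
  by rewrite rmorphXn /= sqr_ge0.
by rewrite meval0.
Qed.

Lemma level_square_eq0 eps code z : (level_square eps code).@[z] = 0 ->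
  forall i b, code i = Some b -> (P i).@[z] = (-1) ^+ b * eps i.
Proof.
move=> /eqP; rewrite raddf_sum psumr_eq0 => [/allP h i b ib|i _]; last first.
  case: (code i) => [b|] /=; last by rewrite meval0.
  by rewrite rmorphXn /= sqr_ge0.
have := h i (mem_index_enum i); rewrite /= ib rmorphXn /= mevalB mevalC.
by rewrite expf_eq0 /= subr_eq0 => /eqP.
Qed.

Lemma level_square_code eps y : (level_square eps (active_code eps y)).@[y] = 0.
Proof.
rewrite raddf_sum big1 // => i _ /=; rewrite ffunE.
case: eqP => [h|_]; last by rewrite meval0.
rewrite rmorphXn /= mevalB mevalC -h {1}[(P i).@[y]]realEsign ?num_real //.
by rewrite subrr expr0n.
Qed.

Lemma msize_level_square eps code : (msize (level_square eps code) <= (2 * D).+1)%N.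
Proof.
apply: msize_sum_leq => i _; case: (code i) => [b|]; last by rewrite msize0.
rewrite mulnC; apply: msizeX_leq; apply: msizeD_leq => //.
rewrite msizeN msizeC; lia.
Qed.

(** Each code is read off at the minimiser on the [k]-th cell. Generic levels bound its support;
    indices with the same code share one penalty and one system of critical equations, so [zeros_le]
    counts their distinct critical points. *)
Lemma exists_cell_codes : exists code : 'I_K -> {ffun I -> option bool},
  [/\ forall k, (#|[set i | code k i != None]| <= N)%N,
      forall c, (#|[set k | code k == c]| <= (2 * D) ^ N)%N &
      forall k i, (forall z, F i z = (P i).@[z]) -> 0 < F i (x k) ->
        code k i != Some true].
Proof.
(* Levels below every [|P i (x k)|] leave each [x k] inside its own compact cell. *)
have [eta eta0 etaP] : exists2 eta : R, 0 < eta & forall ki : 'I_K * I,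
    eta <= `|(P ki.2).@[x ki.1]|.
  by apply: pos_lower_bound => -[k i] /=; rewrite normr_gt0 P_neq0.
have [eps eps_lt eps_gen] := generic_levels P eta0.
have eps0 i : 0 < eps i by case/andP: (eps_lt i).
have cc k c : fcont (cell_constraint eps k c).
  case: c => i /=.
    by apply: fcontB; [apply: fcont_norm; exact: fcont_meval|exact: fcont_cst].
  by apply: fcontM => //; exact: fcont_cst.
have ch := fcont_meval (\sum_i 'X_i ^+ (2 * D).+1 : {mpoly R[N]}).
have xin k c : 0 <= cell_constraint eps k c (x k).
  case: c => i /=; last by rewrite -expr2 sqr_ge0.
  rewrite subr_ge0 (le_trans _ (etaP (k, i))) //.
  by case/andP: (eps_lt i) => _ /ltW.
have bnd k z : (forall c, 0 <= cell_constraint eps k c z) -> forall j, `|z j| <= M.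
  by move=> zc; apply: (@F_bounded k) => i; exact: (zc (inr i)).
have [a [y yin ymin]] := strict_minimizers cc ch xin bnd.
pose h := tilted_power_sum (2 * D).+1 a.
have hE z : h.@[z] = (\sum_i 'X_i ^+ (2 * D).+1 : {mpoly R[N]}).@[z] + \sum_i a i * z i.
  rewrite mevalD; congr (_ + _); rewrite raddf_sum; apply: eq_bigr => i _.
  by rewrite /= mevalZ mevalXU.
have {}ymin k z : (forall c, 0 <= cell_constraint eps k c z) -> z <> y k ->
    h.@[y k] < h.@[z] by rewrite !hE; exact: ymin.
have Pge k i : eps i <= `|(P i).@[y k]|.
  by rewrite -subr_ge0; exact: (yin k (inl i)).
have Fgt k i : 0 < F i (y k) * F i (x k).
  rewrite lt_neqAle (yin k (inr i)) andbT eq_sym mulf_neq0 //.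
    by rewrite PF_neq0 // -normr_gt0 (lt_le_trans (eps0 i)).
  exact: PF_neq0 (P_neq0 k i).
exists (fun k => active_code eps (y k)); split.
- move=> k; apply: leq_trans (eps_gen (y k)); apply: subset_leq_card.
  by apply/fintype.subsetP => i; rewrite !inE ffunE; case: ifP.
- move=> c; set A := [set k | _].
  (* Close to [y k] the signs of [F] persist and the inactive polynomials stay above their levels,
     so a nearby point where the active ones keep their values is still in the cell. *)
  have loc k : exists2 rho, 0 < rho & forall z, (forall j, `|z j - y k j| <= rho) ->
      (forall i, 0 < F i z * F i (x k)) /\
      (forall i, active_code eps (y k) i = None -> eps i < `|(P i).@[z]|).
    have near1 i : exists2 d, 0 < d & forall z, (forall j, `|z j - y k j| < d) ->
        0 < F i z * F i (x k).
      by apply: (fcont_gt0 (cc k (inr i))); exact: Fgt.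
    have near2 i : exists2 d, 0 < d & forall z, (forall j, `|z j - y k j| < d) ->
        active_code eps (y k) i = None -> eps i < `|(P i).@[z]|.
      rewrite ffunE; case: eqP => [_|/eqP ne]; first by exists 1.
      have [|d d0 hd] := @fcont_gt0 _ _ _ (y k) (cc k (inl i)).
        by rewrite /= subr_gt0 lt_neqAle eq_sym ne Pge.
      by exists d => // z /hd /=; rewrite subr_gt0.
    have [d1 hd1] := choice (fun i => let: ex_intro2 d a b := near1 i in
      ex_intro (fun d => 0 < d /\ _) d (conj a b)).
    have [d2 hd2] := choice (fun i => let: ex_intro2 d a b := near2 i in
      ex_intro (fun d => 0 < d /\ _) d (conj a b)).
    have [e1 e10 e1P] := pos_lower_bound (fun i => (hd1 i).1).
    have [e2 e20 e2P] := pos_lower_bound (fun i => (hd2 i).1).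
    exists (Num.min e1 e2 / 2); first by rewrite divr_gt0 // lt_min e10.
    move=> z zy; have zlt j : `|z j - y k j| < Num.min e1 e2.
      apply: le_lt_trans (zy j) _; rewrite ltr_pdivrMr // ltr_pMr ?ltr1n //.
      by rewrite lt_min e10.
    split => i.
      apply: (hd1 i).2 => j; apply: lt_le_trans (zlt j) _.
      by rewrite ge_min e1P.
    apply: (hd2 i).2 => j; apply: lt_le_trans (zlt j) _.
    by rewrite ge_min e2P orbT.
  pose Q := level_square eps c.
  have crit k : exists2 d0, 0 < d0 & k \in A -> forall d, 0 < d < d0 ->
      exists z, (forall i, 0 < F i z * F i (x k)) /\
        forall i, (Q + d *: h)^`M(i).@[z] = 0.
    have [|] := boolP (k \in A); last by exists 1.
    rewrite inE => /eqP kc; have [rho rho0 hrho] := loc k.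
    have [||z zr Qz zy|d0 d00 hd0] := @penalty_critical R N Q h (y k) rho rho0.
    - exact: level_square_ge0.
    - by rewrite /Q -kc level_square_code.
    - apply: ymin => // -[i|i] /=; last by apply: ltW; exact: (hrho z zr).1.
      rewrite subr_ge0; case ci: (c i) => [b|].
        rewrite (level_square_eq0 Qz ci) normrM normr_sign mul1r.
        exact: ler_norm.
      by apply: ltW; apply: (hrho z zr).2; rewrite kc.
    exists d0 => // _ d dd0; have [z zr zcrit] := hd0 d dd0.
    exists z; split=> // i; apply: (hrho z _).1 => j; exact: ltW.
  have [d1 hd1] := choice (fun k => let: ex_intro2 d a b := crit k in
      ex_intro (fun d => 0 < d /\ _) d (conj a b)).
  (* A single [d] must serve all [k] in [A], so that the critical points solve one and the same
     system. *)
  have [e e0 eP] := pos_lower_bound (fun k => (hd1 k).1).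
  pose d := e / 2; have d0 : 0 < d by rewrite divr_gt0.
  have dlt k : 0 < d < d1 k.
    rewrite d0 (lt_le_trans _ (eP k)) // ltr_pdivrMr // ltr_pMr ?ltr1n //.
  have [z hz] := choice (fun a : 'I_#|A| => (hd1 (enum_val a)).2 (enum_valP a) d (dlt _)).
  pose low i : {mpoly R[N]} := Q^`M(i) + (d * a i)%:MP.
  apply: (@zeros_le R N #|A| z _ (2 * D) (d * (2 * D).+1%:R) low).
  (* A common critical point would share the signs of all [F i] with two different points [x k],
     against [F_sep]. *)
  + move=> k l zkl; apply/eqP; apply: contraT => kl.
    have kl' : enum_val k != enum_val l by rewrite (inj_eq enum_val_inj).
    have [i iP] := F_sep kl'.
    have := (hz k).1 i; have := (hz l).1 i; rewrite zkl; move: iP.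
    set f := F i (z l); set g := F i _; set g' := F i _ => gg' fg' fg.
    have : 0 < (f * g) * (f * g') by rewrite mulr_gt0.
    have -> : f * g * (f * g') = f ^+ 2 * (g * g') by ring.
    by rewrite ltNge mulr_ge0_le0 ?sqr_ge0 // ltW.
  + by rewrite mulf_neq0 ?pnatr_eq0 // gt_eqF.
  + move=> i; apply: msizeD_leq.
      by apply: msize_deriv_leq; exact: msize_level_square.
    rewrite msizeC; lia.
  + move=> k i; have := (hz k).2 i; rewrite mderivD mderivZ.
    rewrite mderiv_tilted_power_sum scalerDr scalerA addrCA.
    by rewrite -[d *: (a i)%:MP]mul_mpolyC -mpolyCM.
- move=> k i FP Fx; rewrite ffunE; case: ifP => // _.
  by have := Fgt k i; rewrite pmulr_lgt0 // FP => /ltW; rewrite leNgt => /negPf ->.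
Qed.

End Cells.

(** * Counting codes of small support *)

Definition sparse_codes (T : finType) (N : nat) : {set {ffun T -> option bool}} :=
  [set c : {ffun T -> option bool} | (#|[set i | c i != None]| <= N)%N].

(** A support [S] carries [2 ^ #|S|] codes, one free sign at each of its points; the supports are
    then grouped by size. *)
Lemma card_sparse_codes (m N : nat) :
  (#|sparse_codes 'I_m N| = \sum_(0 <= l < N.+1) 2 ^ l * 'C(m, l))%N.
Proof.
pose supp (c : {ffun 'I_m -> option bool}) := [set i | c i != None].
have card_supp (S : {set 'I_m}) : #|[set c | supp c == S]| = (2 ^ #|S|)%N.
  have <- : #|[set Some true; Some false]| = 2%N by rewrite cards2.
  rewrite -(card_pffun_on None (mem S)); apply: eq_card => c; rewrite inE.
  apply/eqP/pffun_onP => [<-|[sS cS]].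
    split=> [|_ /fintype.imageP[i iS ->]]; first by apply/fintype.subsetP => i; rewrite !inE.
    by move: iS; rewrite !inE; case: (c i) => [[]|].
  apply/setP => i; rewrite inE; apply/idP/idP => [ci|iS].
    by move/fintype.subsetP: sS; apply; rewrite inE.
  by have := cS (c i) (fintype.image_f c iS); rewrite !inE => /orP[] /eqP ->.
rewrite -sum1_card (partition_big supp (fun S => #|S| <= N)%N) /=; last first.
  by move=> c; rewrite inE.
transitivity (\sum_(S : {set 'I_m} | (#|S| <= N)%N) 2 ^ #|S|)%N.
  apply: eq_bigr => S SN; rewrite -card_supp -sum1_card; apply: eq_bigl => c.
  by rewrite [RHS]inE andbC; case: eqP => //= e; rewrite inE -/(supp c) e.
rewrite (partition_big (fun S : {set 'I_m} => inord #|S| : 'I_N.+1) predT) //=.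
rewrite big_mkord; apply: eq_bigr => l _.
rewrite -[in 'C(m, l)](card_ord m) -card_draws -sum1_card big_distrr /=.
apply: eq_big => [S|S /andP[SN /eqP <-]]; last by rewrite inordK ?muln1.
rewrite inE; apply/andP/eqP => [[SN /eqP <-]|Sl]; first by rewrite inordK.
rewrite Sl; split; first by rewrite -ltnS.
by apply/eqP/val_inj; rewrite /= inordK.
Qed.

(** The coordinate [None] has only two admissible values, recorded by a Boolean, and restriction to
    ['I_m] cannot enlarge the support. *)
Lemma card_option_codes (m N : nat) :
  (#|[set c in sparse_codes (option 'I_m) N | c None != Some true]| <=
   2 * #|sparse_codes 'I_m N|)%N.
Proof.
pose f (c : {ffun option 'I_m -> option bool}) : bool * {ffun 'I_m -> option bool} :=
  (c None == None, [ffun i => c (Some i)]).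
set C := [set c in _ | _].
have finj : {in C &, injective f}.
  move=> c c'; rewrite !inE => /andP[_ cN] /andP[_ c'N] [eN eS].
  apply/ffunP => -[i|].
    by have := congr1 (fun g : {ffun _ -> _} => g i) eS; rewrite !ffunE.
  by move: cN c'N eN; case: (c None) => [[]|] //; case: (c' None) => [[]|].
have -> : (2 * #|sparse_codes 'I_m N| = #|finset.setX [set: bool] (sparse_codes 'I_m N)|)%N.
  by rewrite cardsX cardsT card_bool.
rewrite -(card_in_imset finj); apply: subset_leq_card.
apply/fintype.subsetP => _ /imsetP[c + ->].
rewrite !inE => /andP[cN _] /=; apply: leq_trans cN.
have sub : Some @: [set i | c (Some i) != None] \subset [set i | c i != None].
  by apply/fintype.subsetP => _ /imsetP[i + ->]; rewrite !inE.
apply: leq_trans (subset_leq_card sub); rewrite card_imset; last exact: Some_inj.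
by apply: eq_leq; apply: eq_card => i; rewrite !inE ffunE.
Qed.

(* The extra constraint [rho - |z|^2 > 0] makes the cells bounded; its level is
   attained with a positive sign only, whence the single factor 2. *)
Lemma sign_cells_le (R : realType) (N m D K : nat) (P : 'I_m -> {mpoly R[N]})
    (F : 'I_m -> ('I_N -> R) -> R) (x : 'I_K -> 'I_N -> R) :
    (1 < D)%N -> (forall i, (msize (P i) <= D.+1)%N) ->
    (forall i, fcont (F i)) ->
    (forall i z, (P i).@[z] != 0 -> F i z != 0) ->
    (forall k i, (P i).@[x k] != 0) ->
    (forall k l, k != l -> exists i, F i (x k) * F i (x l) < 0) ->
  (K <= 2 * (2 * D) ^ N * \sum_(0 <= l < N.+1) 2 ^ l * 'C(m, l))%N.
Proof.
move=> D1 sP cF PF Px sep.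
pose rho : R := 1 + \sum_k \sum_j x k j ^+ 2.
pose ball : {mpoly R[N]} := rho%:MP - \sum_j 'X_j ^+ 2.
have ballE z : ball.@[z] = rho - \sum_j z j ^+ 2.
  rewrite mevalB mevalC; congr (_ - _); rewrite raddf_sum /=.
  by apply: eq_bigr => j _; rewrite rmorphXn /= mevalXU.
have ballx k : 0 < ball.@[x k].
  rewrite ballE /rho (bigD1 k) //= subr_gt0 addrCA ltrDl ltr_pwDl //.
  by apply: sumr_ge0 => l _; apply: sumr_ge0 => j _; exact: sqr_ge0.
pose P' (o : option 'I_m) := if o is Some i then P i else ball.
pose F' (o : option 'I_m) z := if o is Some i then F i z else ball.@[z].
have [||||||code [codeN codeD code0]] :=
    @exists_cell_codes R N D K _ P' F' x (rho + 1) (ltnW D1).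
(* The ball polynomial has degree at most two, within the bound because [1 < D]. *)
- case=> [i|] //=; apply: msizeD_leq; first by rewrite msizeC; lia.
  rewrite msizeN; apply: msize_sum_leq => j _.
  by rewrite mpolyXn msizeX mdegMn mdeg1 mul1n ltnS.
- by case=> [i|] /=; [exact: cF|exact: fcont_meval].
- by case=> [i|] //= z; exact: PF.
- by move=> k [i|] //=; rewrite gt_eqF.
- by move=> k l /sep[i Fi]; exists (Some i).
- move=> k z /(_ None) /=; rewrite pmulr_lge0 // ballE subr_ge0 => zr j.
  have : z j ^+ 2 <= rho.
    apply: le_trans zr; rewrite (bigD1 j) //= lerDl.
    by apply: sumr_ge0 => l _; exact: sqr_ge0.
  rewrite -real_normK ?num_real // => h.
  have : 0 <= (`|z j| - 1) ^+ 2 by exact: sqr_ge0.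
  have := normr_ge0 (z j); nra.
set C := [set c in sparse_codes (option 'I_m) N | c None != Some true].
have -> : K = (\sum_(c in C) #|[set k | code k == c]|)%N.
  rewrite -[LHS]card_ord -sum1_card (partition_big code (mem C)) /=; last first.
    by move=> k _; rewrite !inE codeN; apply: code0 => //; exact: ballx.
  apply: eq_bigr => c _; rewrite -sum1_card; apply: eq_bigl => k.
  by rewrite inE.
apply: (@leq_trans (\sum_(c in C) (2 * D) ^ N)%N).
  by apply: leq_sum => c _; exact: codeD.
rewrite sum_nat_const -card_sparse_codes mulnAC leq_mul2r.
by rewrite card_option_codes orbT.
Qed.

(** * The norm of a sum of roots *)

Section Exponents.
Context (s' q' : nat).
Local Notation s := s'.+1.
Local Notation q := q'.+1.
Local Notation E := {ffun 'I_q -> 'I_s}.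
Local Notation X := {ffun 'I_q.+1 -> 'I_s}.

(** The class of [1] modulo [s]; for [s = 1] it is [0], and every increment wraps around. *)
Definition step : 'I_s := inZp 1.

Lemma val_step (u : 'I_s) : (u + step : 'I_s) = (if u == s' :> nat then 0 else u.+1)%N :> nat.
Proof.
rewrite /= modnDmr addn1; case: eqP => [->|us]; first exact: modnn.
by rewrite modn_small // ltnS ltn_neqAle -ltnS ltn_ord andbT; apply/eqP.
Qed.

(* The exponent vector with last coordinates [e] whose entries sum to [t] mod [s]. *)
Definition full (t : 'I_s) (e : E) : X :=
  [ffun j => if unlift ord0 j is Some i then e i else t - \sum_i e i].

Definition tail (x : X) : E := [ffun i => x (lift ord0 i)].

Definition unitx (j : 'I_q.+1) : X := [ffun i => if i == j then step else 0].

Lemma full0 t e : full t e ord0 = t - \sum_i e i.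
Proof. by rewrite ffunE unlift_none. Qed.

Lemma fullS t e i : full t e (lift ord0 i) = e i.
Proof. by rewrite ffunE liftK. Qed.

Lemma full_sum t e : \sum_j full t e j = t.
Proof.
rewrite big_ord_recl full0.
have -> : \sum_(i < q) full t e (lift ord0 i) = \sum_i e i.
  by apply: eq_bigr => i _; rewrite fullS.
by rewrite subrK.
Qed.

Lemma fullK t : cancel (full t) tail.
Proof. by move=> e; apply/ffunP => i; rewrite ffunE fullS. Qed.

Lemma tailK t (x : X) : \sum_j x j = t -> full t (tail x) = x.
Proof.
move=> xt; apply/ffunP => j; case: (unliftP ord0 j) => [i|] ->.
  by rewrite fullS ffunE.
rewrite full0 -xt big_ord_recl; under [X in _ - X]eq_bigr do rewrite ffunE.
by rewrite addrK.
Qed.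

Lemma unitx_sum j : \sum_i unitx j i = step.
Proof. by rewrite (bigD1 j) //= ffunE eqxx big1 ?addr0 // => i ij; rewrite ffunE (negPf ij). Qed.

(** With the degree fixed modulo [s], a monomial is indexed by its tail; this is the index reached
    from [e] on multiplying by the [j]-th root, exponents taken modulo [s]. *)
Definition target (e : E) (j : 'I_q.+1) : E := tail (full 0%R e + unitx j).

Lemma full_target e j : full step (target e j) = full 0%R e + unitx j.
Proof.
rewrite tailK //; under eq_bigr do rewrite ffunE.
by rewrite big_split /= full_sum unitx_sum add0r.
Qed.

Lemma target_inj j : injective (target ^~ j).
Proof.
move=> e e' /(congr1 (full step)); rewrite !full_target => /addIr.
exact: can_inj (fullK 0) _ _.
Qed.

Definition weight (x : X) : nat := (\sum_j x j)%N.

(** An exponent passing from [s'] to [0] loses [s]; such an overflow is where a factor [g j] splits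
    off. *)
Lemma weight_unitx (x : X) j :
  ((weight x).+1 = weight (x + unitx j)%R + s * (x j == s' :> nat))%N.
Proof.
rewrite /weight (bigD1 j) //= [in RHS](bigD1 j) //= ffunE [unitx j j]ffunE eqxx.
rewrite (val_step (x j)).
have -> : (\sum_(i | i != j) (x + unitx j)%R i = \sum_(i | i != j) x i)%N.
  by apply: eq_bigr => i ij; rewrite ffunE [unitx j i]ffunE (negPf ij) addr0.
case: eqP => [->|_]; first by rewrite muln1 add0n [RHS]addnC addSn.
by rewrite muln0 addn0 addSn.
Qed.

(** Translating the tail by one [step] in a single coordinate turns the first exponents for degree
    [1] into those for degree [0]; the tails contribute equally to both sides. *)
Lemma sum_weight : (\sum_(e : E) weight (full 0%R e) = \sum_(e : E) weight (full step e))%N.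
Proof.
pose zc (t : 'I_s) (e : E) := nat_of_ord (t - \sum_i e i).
have wE t e : weight (full t e) = (zc t e + \sum_i e i)%N.
  rewrite /weight big_ord_recl full0; congr (_ + _)%N.
  by apply: eq_bigr => i _; rewrite fullS.
under eq_bigr do rewrite wE; under [RHS]eq_bigr do rewrite wE.
rewrite !big_split /=; congr (_ + _)%N.
pose d : E := [ffun i => if i == ord0 then step else 0].
rewrite [RHS](reindex_inj (addIr d)) /=; apply: eq_bigr => e _.
rewrite /zc; congr (nat_of_ord _).
under [in RHS]eq_bigr do rewrite ffunE.
rewrite big_split; have -> : \sum_i d i = step.
  by rewrite (bigD1 ord0) //= ffunE eqxx big1 ?addr0 // => i i0; rewrite ffunE (negPf i0).
by rewrite opprD addrCA subrr addr0 sub0r.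
Qed.

Section Norm.
Context (A : comRingType).
Implicit Types (a g : 'I_q.+1 -> A).

Definition carry g e j : A := if full 0%R e j == s' :> nat then g j else 1.

(* Multiplication by [\sum_j a j * u j], where [u j ^+ s = g j], from the span of
   the monomials [u ^ e] of degree [0] mod [s] to those of degree [1] mod [s]. *)
Definition mul_mx a g : 'M[A]_#|E| := \matrix_(i, k)
  \sum_j (if target (enum_val i) j == enum_val k then a j * carry g (enum_val i) j else 0).

Lemma sum_enum_val (y : E) (G : E -> A) :
  \sum_(k < #|E|) (if y == enum_val k then G (enum_val k) else 0) = G y.
Proof.
rewrite (bigD1 (enum_rank y)) //= enum_rankK eqxx.
rewrite big1 ?addr0 // => k kn; case: eqP => // yk.
by move: kn; rewrite yk enum_valK eqxx.
Qed.

Lemma mul_mxD a b g t : mul_mx (fun j => a j + t * b j) g = mul_mx a g + t *: mul_mx b g.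
Proof.
apply/matrixP => i k; rewrite !mxE big_distrr -big_split /=.
apply: eq_bigr => j _; case: ifP => _; last by rewrite mulr0 addr0.
by ring.
Qed.

Lemma mul_mx_eigen a g (u : 'I_q.+1 -> A) : (forall j, u j ^+ s = g j) ->
  let mon t e := \prod_j u j ^+ full t e j in
  mul_mx a g *m \col_k mon step (enum_val k) =
  (\sum_j a j * u j) *: \col_k mon 0 (enum_val k).
Proof.
move=> us mon; apply/matrixP => i z; rewrite !mxE.
under eq_bigr do rewrite !mxE big_distrl /=.
rewrite exchange_big big_distrl /=; apply: eq_bigr => j _.
have := sum_enum_val (target (enum_val i) j) (fun e => a j * carry g (enum_val i) j * mon step e).
move=> e; apply: etrans (etrans _ e) _.
  by apply: eq_bigr => k _; case: ifP; rewrite ?mul0r.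
rewrite /mon full_target -mulrA -[RHS]mulrA; congr (_ * _).
rewrite (bigD1 j) //= [in RHS](bigD1 j) //= !mulrA; congr (_ * _); last first.
  by apply: eq_bigr => l lj; rewrite ffunE [unitx j l]ffunE (negPf lj) addr0.
rewrite ffunE [unitx j j]ffunE eqxx (val_step (full 0%R _ j)) /carry.
by case: eqP => [->|_]; rewrite ?mulr1 ?mul1r -exprS.
Qed.

End Norm.

Lemma map_mul_mx (A B : comRingType) (phi : {rmorphism A -> B}) (a g : 'I_q.+1 -> A) :
  map_mx phi (mul_mx a g) = mul_mx (phi \o a) (phi \o g).
Proof.
apply/matrixP => i k; rewrite !mxE rmorph_sum /=; apply: eq_bigr => j _.
by case: ifP => _; rewrite ?rmorph0 // rmorphM /carry; case: ifP; rewrite ?rmorph1.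
Qed.

(** Rows and columns have the same total weight by [sum_weight], so the [s ^ q] unit increments are
    offset by exactly [s ^ q'] overflows of size [s]. *)
Lemma perm_weight (pi : 'S_#|E|) :
  (\sum_(i < #|E|) (weight (full 0%R (enum_val i))).+1 =
   \sum_(i < #|E|) weight (full step (enum_val (pi i))) + s * s ^ q')%N.
Proof.
have wE t : (\sum_(i < #|E|) weight (full t (enum_val i)) = \sum_(e : E) weight (full t e))%N.
  by rewrite [RHS](reindex (fun i : 'I_#|E| => enum_val i)) //; exact: onW_bij _ (enum_val_bij _).
under eq_bigr do rewrite -addn1; rewrite big_split /= sum1_card wE.
have -> : (\sum_(i < #|E|) weight (full step (enum_val (pi i))) =
    \sum_(i < #|E|) weight (full step (enum_val i)))%N.
  by rewrite [RHS](reindex_inj (@perm_inj _ pi)).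
by rewrite wE sum_weight !card_ord card_ffun !card_ord -expnS.
Qed.

(** In a nonzero Leibniz term the number of overflows, hence of factors [g j], is exactly [s ^ q']
    by [perm_weight]; all other factors are constants. *)
Lemma msize_norm (R : idomainType) (N Delta : nat) (a : 'I_q.+1 -> R)
    (g : 'I_q.+1 -> {mpoly R[N]}) :
    (forall j, (msize (g j) <= Delta.+1)%N) ->
  (msize (\det (mul_mx (fun j => (a j)%:MP) g)) <= (s ^ q' * Delta).+1)%N.
Proof.
move=> gD; apply: msize_sum_leq => pi _.
rewrite -signr_odd -[in X in (X <= _)%N](mulrC _ _).
have sgn (b : bool) (p : {mpoly R[N]}) : msize (p * (-1) ^+ b) = msize p.
  by case: b; rewrite ?expr1 ?expr0 ?mulrN1 ?mulr1 ?msizeN.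
rewrite sgn; set pr := \prod_i _.
have [->|pr0] := eqVneq pr 0; first by rewrite msize0.
pose p (i : 'I_#|E|) := (weight (full 0%R (enum_val i))).+1.
pose r (i : 'I_#|E|) := weight (full step (enum_val i)).
(* The overflow count of row [i] is read off the weights, so it is the same for all [j] that
   contribute to the entry. *)
pose w i := ((p i - r (pi i)) %/ s)%N.
have key i j : target (enum_val i) j == enum_val (pi i) ->
    (p i = r (pi i) + s * (full 0%R (enum_val i) j == s' :> nat))%N.
  rewrite /p /r => /eqP <-; rewrite full_target; exact: weight_unitx.
have wE i : (p i = r (pi i) + s * w i)%N.
  have [j tj] : exists j, target (enum_val i) j == enum_val (pi i).
    apply: contrapT => nj; move/prodf_neq0: pr0 => /(_ i isT).
    rewrite mxE big1 ?eqxx // => j _; case: ifP => // tj.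
    by case: nj; exists j.
  by rewrite /w (key i j tj) addKn mulKn.
have -> : (s ^ q' * Delta = \sum_i w i * Delta)%N.
  rewrite -big_distrl /=; congr (_ * _)%N.
  have := perm_weight pi; rewrite (eq_bigr _ (fun i _ => wE i)) big_split /=.
  by move=> /addnI; rewrite -big_distrr /= => /eqP; rewrite eqn_pmul2l // => /eqP.
apply: msize_prod_leq => i _; rewrite mxE; apply: msize_sum_leq => j _.
case: ifP => [tj|_]; last by rewrite msize0.
have <- : (full 0%R (enum_val i) j == s' :> nat : nat) = w i.
  by rewrite /w (key i j tj) addKn mulKn.
rewrite mul_mpolyC (leq_trans (msizeZ_le _ _)) // /carry.
by case: ifP => _; rewrite ?mul1n // msize1.
Qed.

(** * Vanishing and genericity of the norm over the reals *)

Section RealNorm.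
Context (R : realType).
Implicit Types (a g u : 'I_q.+1 -> R).

(** A nonzero Leibniz term could have no overflow, since each brings a factor [g j = 0]; but
    [perm_weight] demands some. *)
Lemma norm_eq0_zero a g : (forall j, g j = 0) -> \det (mul_mx a g) = 0.
Proof.
move=> g0; apply: big1 => pi _.
suff -> : \prod_i mul_mx a g i (pi i) = 0 by rewrite mulr0.
apply/eqP; apply: contraT => /prodf_neq0 pr0; exfalso.
have := perm_weight pi.
rewrite (eq_bigr (fun i => weight (full step (enum_val (pi i))))).
  move=> /eqP; rewrite -[X in (X == _)%N]addn0 eqn_add2l eq_sym muln_eq0 /=.
  by rewrite expn_eq0.
move=> i _; apply: contrapT => wi; have /eqP := pr0 i isT; apply.
rewrite mxE big1 // => j _; case: ifP => // /eqP tj.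
rewrite /carry; case: eqP => [_|ns]; first by rewrite g0 mulr0.
case: wi; rewrite -tj full_target (weight_unitx _ j).
by move/eqP/negPf: ns => ->; rewrite muln0 addn0.
Qed.

(** At a zero of the sum the vector of degree-one monomials lies in the kernel by [mul_mx_eigen];
    its entry with exponents [unitx j] is nonzero when [u j != 0]. If all [u j] vanish,
    [norm_eq0_zero] takes over. *)
Lemma norm_eq0 a g u : (forall j, u j ^+ s = g j) -> \sum_j a j * u j = 0 ->
  \det (mul_mx a g) = 0.
Proof.
move=> us f0.
have [/forallP u0|] := boolP [forall j, u j == 0].
  by apply: norm_eq0_zero => j; rewrite -us (eqP (u0 j)) expr0n.
rewrite negb_forall => /existsP[j uj].
pose v : 'rV[R]_#|E| := \row_k \prod_i u i ^+ full step (enum_val k) i.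
apply/eqP; rewrite -det_tr; apply/det0P; exists v.
  have zs : \sum_i unitx j i = step by exact: unitx_sum.
  apply/eqP => /(congr1 (fun M : 'rV_ _ => M 0 (enum_rank (tail (unitx j))))).
  rewrite !mxE enum_rankK tailK // => /eqP/prodf_eq0[i _].
  rewrite ffunE; case: (eqVneq i j) => [->|_]; last by rewrite /= expr0 oner_eq0.
  by rewrite expf_eq0 (negPf uj) andbF.
apply: trmx_inj; rewrite trmx_mul trmxK trmx0.
have -> : v^T = \col_k \prod_i u i ^+ full step (enum_val k) i.
  by apply/matrixP => k z; rewrite !mxE.
by rewrite (mul_mx_eigen a us) f0 scale0r.
Qed.

Definition deltaf (j : 'I_q.+1) : 'I_q.+1 -> R := fun i => (i == j)%:R.

(** With a single term the matrix has one nonzero entry in each row, in columns made distinct by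
    [target_inj], and its inverse [B] is explicit. *)
Lemma norm_delta_neq0 g j : g j != 0 -> \det (mul_mx (deltaf j) g) != 0.
Proof.
move=> gj; rewrite -unitfE -unitmxE.
pose c (i : 'I_#|E|) := carry g (enum_val i) j.
have c0 i : c i != 0 by rewrite /c /carry; case: ifP => // _; exact: oner_neq0.
have ME i k : mul_mx (deltaf j) g i k =
    if target (enum_val i) j == enum_val k then c i else 0.
  rewrite mxE (bigD1 j) //= big1 ?addr0 => [|l lj].
    by rewrite /deltaf eqxx mul1r.
  by rewrite /deltaf (negPf lj) mul0r if_same.
pose B : 'M[R]_#|E| := \matrix_(k, i)
  if target (enum_val i) j == enum_val k then (c i)^-1 else 0.
have /mulmx1_unit[] // : mul_mx (deltaf j) g *m B = 1%:M.
apply/matrixP => i i'; rewrite !mxE.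
have := sum_enum_val (target (enum_val i) j) (fun e => c i * if target (enum_val i') j == e then (c i')^-1 else 0).
move=> e; apply: etrans (etrans _ e) _.
  by apply: eq_bigr => k _; rewrite ME mxE; case: ifP; rewrite ?mul0r.
rewrite (inj_eq (@target_inj j)) (inj_eq enum_val_inj) eq_sym.
by case: eqP => [->|_]; rewrite ?mulr0 // mulfV.
Qed.

Lemma norm_line a b g : exists p : {poly R},
  forall t, p.[t] = \det (mul_mx (fun j => a j + t * b j) g).
Proof.
exists (\det (mul_mx (fun j => (a j)%:P + 'X * (b j)%:P) (fun j => (g j)%:P))) => t.
rewrite -horner_evalE -det_map_mx map_mul_mx; congr (\det (mul_mx _ _)).
  by apply/funext => j /=; rewrite horner_evalE !hornerE.
by apply/funext => j /=; rewrite horner_evalE hornerC.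
Qed.

(** One point is treated at a time: along a coordinate [j] with [G k j != 0], the norms at the new
    and the old points are nonzero polynomials in the parameter, so a small parameter avoids all
    their roots. *)
Lemma perturb_coeffs (K : nat) (G : 'I_K -> 'I_q.+1 -> R) a (eta : R) : 0 < eta ->
    (forall k, exists j, G k j != 0) ->
  exists2 b, forall j, `|b j - a j| < eta & forall k, \det (mul_mx b (G k)) != 0.
Proof.
move=> eta0 Gn.
suff H (L : seq 'I_K) : forall eta, 0 < eta ->
    exists2 b, forall j, `|b j - a j| < eta &
      forall k, k \in L -> \det (mul_mx b (G k)) != 0.
  have [b ba bL] := H (enum 'I_K) eta eta0; exists b => // k.
  by apply: bL; rewrite mem_enum.
elim: L {eta eta0} => [|k L ih] eta eta0.
  by exists a => // j; rewrite subrr normr0.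
have eta2 : 0 < eta / 2 by rewrite divr_gt0.
have [b ba bL] := ih _ eta2; have [j Gkj] := Gn k.
have [p hp] := choice (fun l => norm_line b (deltaf j) (G l)).
have pL l : l \in L -> p l != 0.
  move=> /bL; apply: contra_neq => pl0; have := hp l 0; rewrite pl0 horner0 => ->.
  by congr (\det (mul_mx _ _)); apply/funext => i; rewrite mul0r addr0.
(* By homogeneity the norm at [b + y^-1 * deltaf j] is, up to a power of [y], the norm at
   [deltaf j + y * b], which is nonzero at [y = 0] and hence at some small [y > 0]. *)
have pk : p k != 0.
  have [r hr] := norm_line (deltaf j) b (G k).
  have r0 : r != 0.
    apply: contraTneq (norm_delta_neq0 Gkj) => r0; have := hr 0.
    rewrite r0 horner0 negbK => /esym/eqP; congr (_ == _); congr (\det (mul_mx _ _)).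
    by apply/funext => i; rewrite mul0r addr0.
  have [y /andP[y0 _] nr] := nonroot_small r0 ltr01.
  apply: contraNneq nr => pk0; rewrite /root hr.
  have -> : (fun i => deltaf j i + y * b i) = (fun i => 0 + y * (b i + y^-1 * deltaf j i)).
    by apply/funext => i; rewrite add0r mulrDr mulVKf ?gt_eqF // addrC.
  rewrite mul_mxD (_ : mul_mx (fun=> 0) (G k) = 0) ?add0r; last first.
    by apply/matrixP => i l; rewrite !mxE big1 // => h _; rewrite mul0r if_same.
  by rewrite detZ -hp pk0 horner0 mulr0.
have [||t /andP[t0 te] nr] := @nonroot_small _ (\prod_(l <- k :: L) p l) (eta / 2).
- rewrite prodf_seq_neq0; apply/allP => l; rewrite inE => /predU1P[->|/pL] //=.
- exact: eta2.
exists (fun i => b i + t * deltaf j i) => [i|l lkL].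
  have -> : b i + t * deltaf j i - a i = (b i - a i) + t * deltaf j i by ring.
  apply: le_lt_trans (ler_normD _ _) _; rewrite [ltRHS](splitr eta) ltr_leD //.
  rewrite /deltaf; case: eqP => _; rewrite ?mulr1 ?mulr0 ?normr0 ?(ltW eta2) //.
  by rewrite gtr0_norm // ltW.
rewrite -hp; apply: contraNneq nr => pl0; rewrite /root horner_prod.
by rewrite prodf_seq_eq0; apply/hasP; exists l => //=; rewrite pl0.
Qed.

End RealNorm.
End Exponents.

(** * Sign patterns *)

Lemma meval_affine (R : comRingType) (N : nat) (p : {mpoly R[N]}) (x y : 'I_N -> R) t :
  (msize p <= 2)%N ->
  p.@[fun i => y i + t * (x i - y i)] = p.@[y] + t * (p.@[x] - p.@[y]).
Proof.
move=> p2; rewrite !mevalE -sumrB big_distrr -big_split /= !big_seq.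
apply: eq_bigr => m mp; rewrite -mulrBr mulrCA -mulrDr; congr (_ * _).
rewrite -!mevalX.
have : (mdeg m < 2)%N by exact: leq_trans (msize_mdeg_lt mp) p2.
case mE: (mdeg m) => [|[|]] // _.
  by move/eqP: mE; rewrite mdeg_eq0 => /eqP ->; rewrite mpolyX0 !meval1 subrr mulr0 addr0.
by move/eqP/mdeg1P: mE => [i /eqP ->]; rewrite !mevalXU.
Qed.

Lemma affine_ge0_const (R : realFieldType) (N : nat) (p : {mpoly R[N]}) :
  (msize p <= 2)%N -> (forall x, 0 <= p.@[x]) -> forall x y, p.@[x] = p.@[y].
Proof.
move=> p2 p0 x y; apply/eqP; rewrite -subr_eq0; apply: contraT => d0.
set d := _ - _ in d0.
(* The parameter is chosen so that the affine function takes the value [-1]. *)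
have := p0 (fun i => y i + (- (p.@[y] + 1) / d) * (x i - y i)).
by rewrite meval_affine // -/d mulfVK // opprD addrA subrr add0r oppr_ge0 ler10.
Qed.

Lemma pad_sum (R : pzSemiRingType) (k r : nat) (h : 'I_k -> R) : (k <= r)%N ->
  \sum_j h j = \sum_(j < r) (if insub (j : nat) is Some i then h i else 0).
Proof.
move=> kr.
pose H (j : nat) := if insub j is Some i then h i else 0.
transitivity (\sum_(j < k) H j).
  by apply: eq_bigr => j _; rewrite /H valK.
rewrite (big_ord_widen r H kr) big_mkcond /=; apply: eq_bigr => j _.
rewrite /H; case: ifP => // jk; case: insubP => // i; by rewrite jk.
Qed.

(** * Cells of sums of roots *)

Section RootSums.
Context (R : realType) (N m K s' q' Delta : nat).
Local Notation s := s'.+1.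
Local Notation r := q'.+2.
Variables (a : 'I_m -> 'I_r -> R) (g : 'I_m -> 'I_r -> {mpoly R[N]}).
Variable x : 'I_K -> 'I_N -> R.

Definition root_sum (b : 'I_m -> 'I_r -> R) i (z : 'I_N -> R) : R :=
  \sum_j b i j * (g i j).@[z] `^ (s%:R^-1).

Hypothesis Delta_gt1 : (1 < Delta)%N.
Hypothesis g_size : forall i j, (msize (g i j) <= Delta.+1)%N.
Hypothesis g_ge0 : forall i j z, 0 <= (g i j).@[z].
Hypothesis f_neq0 : forall k i, root_sum a i (x k) != 0.
Hypothesis f_sep : forall k l, k != l ->
  exists i, root_sum a i (x k) * root_sum a i (x l) < 0.

(** After a small change of the coefficients the norms are nonzero at all [x k] while the signs of
    the sums there persist; the norms then serve as the polynomials [P] of [sign_cells_le]. *)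
Lemma root_sum_cells_le :
  (K <= 2 * (2 * (s ^ q' * Delta)) ^ N * \sum_(0 <= l < N.+1) 2 ^ l * 'C(m, l))%N.
Proof.
pose u i z j := (g i j).@[z] `^ (s%:R^-1).
have u_ge0 i z j : 0 <= u i z j by exact: powR_ge0.
have u_expr i z j : u i z j ^+ s = (g i j).@[z] by exact: powR_invn_expr.
have [b hb] : exists b : 'I_m -> 'I_r -> R, forall i,
    (forall k, 0 < root_sum b i (x k) * root_sum a i (x k)) /\
    (forall k, \det (mul_mx s' (b i) (fun j => (g i j).@[x k])) != 0).
  suff step i : exists bi : 'I_r -> R,
      (forall k, 0 < (\sum_j bi j * u i (x k) j) * root_sum a i (x k)) /\
      (forall k, \det (mul_mx s' bi (fun j => (g i j).@[x k])) != 0).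
    by have [b hb] := choice step; exists b.
  have su0 k : 0 < \sum_j u i (x k) j + 1 by rewrite ltr_wpDl // sumr_ge0.
  (* Below this bound a change of coefficients moves each sum at [x k] by less than its absolute
     value; the added [1] keeps the denominator positive and the inequality strict. *)
  have [|eta eta0 etaP] := @pos_lower_bound R 'I_K
      (fun k => `|root_sum a i (x k)| / (\sum_j u i (x k) j + 1)).
    by move=> k; rewrite divr_gt0 // normr_gt0.
  have [|b ba bdet] := @perturb_coeffs s' q' R K (fun k j => (g i j).@[x k]) (a i) eta eta0.
    move=> k; apply: contrapT => ng; have /eqP := f_neq0 k i; apply.
    apply: big1 => j _; have -> : (g i j).@[x k] = 0.
      by apply: contrapT => /eqP gj; apply: ng; exists j.
    by rewrite powR0 ?mulr0 // invr_neq0 // pnatr_eq0.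
  exists b; split=> // k; set f := root_sum a i (x k); set f' := \sum_j _.
  have ff' : `|f' - f| < `|f|.
    rewrite /f' /f /root_sum -sumrB; apply: le_lt_trans (ler_norm_sum _ _ _) _.
    apply: (@le_lt_trans _ _ (eta * \sum_j u i (x k) j)).
      rewrite big_distrr /=; apply: ler_sum => j _.
      by rewrite -mulrBl normrM (ger0_norm (u_ge0 _ _ _)) ler_wpM2r // ltW.
    have := etaP k; rewrite ler_pdivlMr // -/f; apply: lt_le_trans.
    by rewrite ltr_pM2l // ltrDl.
  have f0 : f != 0 by exact: f_neq0.
  (* Expanding the square gives [f' ^+ 2 < 2 * f * f'], so [f] and [f'] have the same sign. *)
  have : (f' - f) ^+ 2 < f ^+ 2.
    by rewrite -[ltLHS]real_normK ?num_real // -[ltRHS]real_normK ?num_real // ltrXn2r.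
  rewrite sqrrB; have := sqr_ge0 f'; rewrite mulr2n; lra.
pose P i : {mpoly R[N]} := \det (mul_mx s' (fun j => (b i j)%:MP) (g i)).
have PE i z : (P i).@[z] = \det (mul_mx s' (b i) (fun j => (g i j).@[z])).
  rewrite /P -det_map_mx map_mul_mx; congr (\det (mul_mx _ _ _)).
  by apply/funext => j /=; rewrite mevalC.
apply: (@sign_cells_le R N m (s ^ q' * Delta) K P (root_sum b) x).
- by rewrite (leq_trans Delta_gt1) // leq_pmull // expn_gt0.
- by move=> i; exact: msize_norm.
- move=> i; apply: fcont_sum => j; apply: fcontZ; apply: fcont_root => //.
  exact: fcont_meval.
- move=> i z; rewrite PE; apply: contra_neq => f0.
  by apply: (norm_eq0 (u_expr i z)).
- by move=> k i; rewrite PE; exact: (hb i).2.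
- move=> k l /f_sep[i fi]; exists i.
  have := (hb i).1 k; have := (hb i).1 l; move: fi.
  set f1 := root_sum a i _; set f2 := root_sum a i _.
  set h2 := root_sum b i _; set h1 := root_sum b i _ => ff hf2 hf1.
  rewrite ltNge; apply/negP => hh.
  have : 0 < (h1 * f1) * (h2 * f2) by rewrite mulr_gt0.
  have -> : h1 * f1 * (h2 * f2) = (h1 * h2) * (f1 * f2) by ring.
  by rewrite ltNge mulr_ge0_le0 // ltW.
Qed.

End RootSums.

Local Open Scope classical_set_scope.

(** A proper pattern is a Boolean vector, true at negative entries; one chosen point for each
    realised vector gives a pairwise separated family, to which the hypothesis applies. *)
Lemma sign_patterns_card_le (R : realType) (N m B : nat)
    (f : 'I_m -> ('I_N -> R) -> R) :
    (forall K (x : 'I_K -> 'I_N -> R), (forall k i, f i (x k) != 0) ->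
      (forall k l, k != l -> exists i, f i (x k) * f i (x l) < 0) -> (K <= B)%N) ->
  (proper_sign_patterns f #<= `I_B)%card.
Proof.
move=> hB.
pose S : {set {ffun 'I_m -> bool}} :=
  finset (fun b : {ffun 'I_m -> bool} => `[< exists x, forall i, f i x != 0 /\ (f i x < 0) = b i >]).
pose tau (b : {ffun 'I_m -> bool}) : {ffun 'I_m -> int} := [ffun i => (-1) ^+ b i].
pose h k := tau (nth [ffun=> false] (enum S) k).
have sub : proper_sign_patterns f `<=` h @` `I_#|S|.
  move=> e [pe [x xe]]; rewrite -{}xe in pe *.
  have fx i : f i x != 0 by have := pe i; rewrite ffunE sgz_eq0.
  pose b : {ffun 'I_m -> bool} := [ffun i => f i x < 0].
  have bS : b \in S by rewrite inE; apply/asboolP; exists x => i; rewrite ffunE.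
  exists (index b (enum S)); first by rewrite /= cardE index_mem mem_enum.
  rewrite /h nth_index ?mem_enum //; apply/ffunP => i.
  by rewrite !ffunE sgz_def fx.
apply: card_le_trans (subset_card_le sub) _.
apply: card_le_trans (card_image_le _ _) _; rewrite card_le_II.
have wit (k : 'I_#|S|) : exists x, forall i, f i x != 0 /\ (f i x < 0) = enum_val k i.
  by have := enum_valP k; rewrite inE => /asboolP.
have [x hx] := choice wit.
apply: (hB _ x) => [k i|k l kl]; first by have [] := hx k i.
have : enum_val k != enum_val l by rewrite (inj_eq enum_val_inj).
move=> /eqP/ffunP ne; have [i ni] : exists i, enum_val k i <> enum_val l i.
  by apply: contrapT => h'; apply: ne => i; apply: contrapT => ni; apply: h'; exists i.
exists i; have [fk ek] := hx k i; have [fl el] := hx l i.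
move: ni; rewrite -ek -el.
case: (ltgtP (f i (x k)) 0) fk => // k0 _; case: (ltgtP (f i (x l)) 0) fl => // l0 _ _.
- by rewrite nmulr_rlt0.
- by rewrite pmulr_rlt0.
Qed.

Theorem theorem2p2 (R : realType) (N m Delta r s : nat)
  (hN : (0 < N)%N) (hm : (0 < m)%N) (hDelta : (0 < Delta)%N)
  (hr : (2 <= r)%N) (hs : (0 < s)%N)
  (f : 'I_m -> ('I_N -> R) -> R)
  (k : 'I_m -> nat) (hk : forall i, (0 < k i <= r)%N)
  (a : forall i : 'I_m, 'I_(k i) -> R)
  (g : forall i : 'I_m, 'I_(k i) -> {mpoly R[N]})
  (hdeg : forall (i : 'I_m) (j : 'I_(k i)), (msize (g i j) <= Delta.+1)%N)
  (hg : forall (i : 'I_m) (j : 'I_(k i)) (x : 'I_N -> R),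
      0 <= (g i j).@[x])
  (hf : forall (i : 'I_m) (x : 'I_N -> R),
      f i x = \sum_(j < k i) a i j * (g i j).@[x] `^ (s%:R^-1)) :
  (proper_sign_patterns f #<=
     `I_(2 * (2 * s ^ (r - 2) * Delta) ^ N *
           \sum_(0 <= l < N.+1) 2 ^ l * 'C(m, l)))%card.
Proof.
apply: sign_patterns_card_le => K x fx sep.
(* For [Delta <= 1] the nonnegative polynomials are constant and at most one pattern occurs; the
   case is split off because the enclosing ball has degree two. *)
have [D1|D1] := leqP Delta 1.
  have fc i y z : f i y = f i z.
    rewrite !hf; apply: eq_bigr => j _; congr (_ * _ `^ _).
    by apply: affine_ge0_const (hg i j) y z; exact: leq_trans (hdeg i j) _.
  apply: (@leq_trans 1).
    rewrite leqNgt; apply/negP => K1.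
    have [|i] := sep (Ordinal (ltnW K1)) (Ordinal K1); first by [].
    by rewrite (fc i (x _) (x (Ordinal K1))) -expr2 ltNge sqr_ge0.
  rewrite !muln_gt0 /= expn_gt0 !muln_gt0 expn_gt0 hs hDelta /=.
  by rewrite big_nat_recl //= bin0 expn0.
case: s hs hf => // s' _ hf; case: r hr hk => [//|[//|q']] _ hk.
rewrite !subSS subn0 -[(2 * _ * Delta)%N]mulnA.
(* Zero coefficients and zero polynomials bring every sum to exactly [r] terms. *)
pose a' i (j : 'I_q'.+2) : R := if insub (j : nat) is Some j' then a i j' else 0.
pose g' i (j : 'I_q'.+2) : {mpoly R[N]} :=
  if insub (j : nat) is Some j' then g i j' else 0.
have fE i z : f i z = root_sum s' g' a' i z.
  rewrite hf (@pad_sum _ _ q'.+2); last by have /andP[] := hk i.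
  apply: eq_bigr => j _; rewrite /a' /g'; case: insubP => // _.
  by rewrite mul0r.
apply: (@root_sum_cells_le R N m K s' q' Delta a' g' x).
- exact: D1.
- by move=> i j; rewrite /g'; case: insubP => [j' _ _|_]; rewrite ?msize0.
- by move=> i j z; rewrite /g'; case: insubP => [j' _ _|_]; rewrite ?meval0.
- by move=> l i; rewrite -fE.
- by move=> l l' /sep[i]; rewrite !fE; exists i.
Qed.
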